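(* Let $\xi$ be a non-negative integer-valued random variable with $\mathbb E\xi=1$ and $0<\operatorname{Var}\xi<\infty$. The function $\mu(\alpha)$ has a continuous extension to the set $\{\alpha\in\mathbb C:\operatorname{Re}\alpha\le\frac12\}\setminus\{\frac12\}$.
   Context: Let $\mathcal T$ be the Galton--Watson tree with offspring distribution $\xi$ (each node has a number of children that is an independent copy of $\xi$), and $|\mathcal T|$ its (a.s. finite) number of nodes. For $\operatorname{Re}\alpha<\frac12$, $\mu(\alpha):=\mathbb E|\mathcal T|^\alpha=\sum_{n\ge1}n^\alpha\,\mathbb P(|\mathcal T|=n)$, which is an analytic function in this half-plane. *)

(* Defs.v *)
From HB Require Import structures.
From mathcomp Require Import all_boot all_order all_algebra.
From mathcomp.real_closed Require Export complex.
From mathcomp Require Import all_classical all_reals all_analysis.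

Set Implicit Arguments.
Unset Strict Implicit.
Unset Printing Implicit Defensive.

Import Order.TTheory GRing.Theory Num.Theory.
Import numFieldNormedType.Exports.

Local Open Scope classical_set_scope.
Local Open Scope ring_scope.
Local Open Scope complex_scope.

(* The norm topology of the plane R[i], as for any numFieldType. *)
#[non_forgetful_inheritance]
HB.instance Definition _ (R : rcfType) :=
  NormedModule.copy R[i] (R[i])^o.

(* Nodes are Ulam-Harris words: the root is [::] and the children of u are the
   words rcons u i with i < c u, where c u is the number of children of u. *)
Inductive gw_node (c : seq nat -> nat) : seq nat -> Prop :=
| gw_root : gw_node c [::]
| gw_child u i : gw_node c u -> (i < c u)%N -> gw_node c (rcons u i).

Definition gw_tree (c : seq nat -> nat) : set (seq nat) := [set v | gw_node c v].

Definition same_law d1 d2 (T1 : measurableType d1) (T2 : measurableType d2)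
    (R : realType) (P1 : probability T1 R) (P2 : probability T2 R)
    (X : {RV P1 >-> nat}) (Y : {RV P2 >-> nat}) : Prop :=
  forall A : set nat, distribution P1 X A = distribution P2 Y A.

Definition mutually_independent d (T : measurableType d) (R : realType)
    (P : probability T R) (I : eqType) (X : I -> {RV P >-> nat}) : Prop :=
  forall (s : seq I) (A : I -> set nat), uniq s ->
    P (\bigcap_(i in [set` s]) (X i @^-1` A i)) =
    (\prod_(i <- s) P (X i @^-1` A i))%E.

(* P (|T| = n), where |T| is the number of nodes of the random tree. *)
Definition progeny_pmf d (T : measurableType d) (R : realType)
    (P : probability T R) (N : seq nat -> {RV P >-> nat}) (n : nat) : R :=
  fine (P [set w | (gw_tree (fun v => N v w) #= `I_n)%card]).

(* n ^ a = exp (a * ln n), for n > 0 *)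
Definition natpowC (R : realType) (n : nat) (a : R[i]) : R[i] :=
  let t := complex.Im a * ln n%:R in
  (expR (complex.Re a * ln n%:R))%:C * (cos t +i* sin t).

(* E |T|^a; the series converges absolutely for Re a < 1/2, where the theorem
   evaluates mu, so limn is a genuine sum there. *)
Definition mu d (T : measurableType d) (R : realType)
    (P : probability T R) (N : seq nat -> {RV P >-> nat}) (a : R[i]) : R[i] :=
  limn (fun m : nat => \sum_(1 <= n < m) natpowC n a * (progeny_pmf N n)%:C).

(* Main.v *)
Require Import Defs.
From HB Require Import structures.
From mathcomp Require Import all_boot all_order all_algebra.
From mathcomp Require Import all_classical all_reals all_analysis.
From mathcomp Require Import measurable_realfun.
From mathcomp Require Import ring lra zify.


(** Write [q n] for the probability that the tree has [n] nodes, and [Phi] for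
    the generating function of the offspring law, which has finite second
    derivative at [1]. No estimate of the individual [q n] is sharp enough on
    the line where the exponent has real part [1 / 2]: with two moments only,
    [q n] is of order [n ^ (- 3 / 2)] with an error term that need not be
    summable after multiplication by [n ^ (1 / 2)]. The proof works with the
    generating function [y (z)] of [q] instead, through the equation
    [y = z * Phi y], which says that [y] inverts [u |-> u / Phi u]
    ([progeny_gf], [progeny_pmfE]).

    Replace [n ^ a] by [beta a n], the integral over [0, 1] of
    [n z ^ (n - 1) (1 - z) ^ (- a)]. After the substitution [z = u / Phi u] the
    sum of [q n * beta a n] becomes the integral of [(1 - u / Phi u) ^ (- a)],
    and since the law has mean [1] and finite variance,
    [1 - u / Phi u = (1 - u) ^ 2 * (gap u / Phi u)], where [gap] and [Phi] are
    increasing, bounded, and bounded away from [0] ([gap_mono], [gap_bounds]).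
    Monotonicity is what replaces a rate of convergence: integrating by parts
    against the primitive [- (1 - u) ^ (1 - 2 a) / (1 - 2 a)] of
    [(1 - u) ^ (- 2 a)] leaves an integral bounded by the total variation of
    [ln gap] and [ln Phi], so that what remains of the integral after removing
    its boundary term ([leading_part]) converges as [u] tends to [1], locally
    uniformly for [a != 1 / 2] with real part at most [1 / 2]
    ([remainder_increment], [limit_remainder_cvg]). The boundary term oscillates
    on the line but vanishes in the limit to the left of it, where the limit is
    therefore the sum of [q n * beta a n] ([cvg_sum_beta]). Primitives are
    written down explicitly, so the mean value inequality
    ([cmod_increment_le]) does the work of complex integration.

    Finally [n ^ a = pow_ratio n a * beta a n], where [pow_ratio] has increments
    of order [n ^ (- 2)]. Summation by parts then writes the sum of
    [q n * n ^ a] as a locally uniformly convergent series built from the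
    continued sum of [q n * beta a n] and its partial sums
    ([corrected_sumS], [corrected_sum_diff]).

    The equation [y = z * Phi y] comes from depth-first exploration: every step
    reads the number of children of a node not read before, which gives the
    recursion [forest_pmf] for the size of a forest ([explore_law]), and the
    powers of the fixed point [u] solve the recursion of its generating
    functions ([forest_gf_bounds]). *)

Set Implicit Arguments.
Unset Strict Implicit.
Unset Printing Implicit Defensive.

Import Order.TTheory GRing.Theory Num.Theory.
Import numFieldNormedType.Exports.

Local Open Scope classical_set_scope.
Local Open Scope ring_scope.
Local Open Scope complex_scope.

(** * Complex numbers: modulus, exponential, mean value inequality *)

Section ComplexAnalysis.
Variable R : realType.
Implicit Types (x y : R) (z w a b : R[i]).

Definition cmod z : R := complex.Re `|z|.

Lemma cmodE z : `|z| = (cmod z)%:C.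
Proof. by rewrite /cmod normc_def. Qed.

Lemma cmod_ge0 z : 0 <= cmod z.
Proof. by rewrite /cmod normc_def /= sqrtr_ge0. Qed.

Lemma cmod0 : cmod 0 = 0. Proof. by rewrite /cmod normr0. Qed.

Lemma cmod1 : cmod 1 = 1. Proof. by rewrite /cmod normr1. Qed.

Lemma cmodM z w : cmod (z * w) = cmod z * cmod w.
Proof. by apply: complexI; rewrite rmorphM /= -!cmodE normrM. Qed.

Lemma cmodN z : cmod (- z) = cmod z. Proof. by rewrite /cmod normrN. Qed.

Lemma cmodB z w : cmod (z - w) = cmod (w - z).
Proof. by rewrite /cmod distrC. Qed.

Lemma cmodD z w : cmod (z + w) <= cmod z + cmod w.
Proof. by rewrite -lecR rmorphD /= -!cmodE ler_normD. Qed.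

Lemma cmodV z : cmod z^-1 = (cmod z)^-1.
Proof. by apply: complexI; rewrite fmorphV /= -!cmodE normfV. Qed.

Lemma cmod_eq0 z : (cmod z == 0) = (z == 0).
Proof. by rewrite -(inj_eq (@complexI R)) /= -cmodE normr_eq0. Qed.

Lemma cmodR x : cmod x%:C = `|x|.
Proof. by rewrite /cmod normc_def /= expr0n addr0 sqrtr_sqr. Qed.

Lemma cmod_sqr z : cmod z ^+ 2 = complex.Re z ^+ 2 + complex.Im z ^+ 2.
Proof. by rewrite /cmod normc_def /= sqr_sqrtr // addr_ge0 ?sqr_ge0. Qed.

Lemma normRe_le_cmod z : `|complex.Re z| <= cmod z.
Proof.
rewrite -ler_sqr ?nnegrE ?cmod_ge0 // cmod_sqr real_normK ?num_real //.
by rewrite lerDl sqr_ge0.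
Qed.

Lemma normIm_le_cmod z : `|complex.Im z| <= cmod z.
Proof.
rewrite -ler_sqr ?nnegrE ?cmod_ge0 // cmod_sqr real_normK ?num_real //.
by rewrite lerDr sqr_ge0.
Qed.

Lemma cmod_le_ReIm z : cmod z <= `|complex.Re z| + `|complex.Im z|.
Proof.
rewrite -ler_sqr ?nnegrE ?cmod_ge0 ?addr_ge0 // cmod_sqr sqrrD.
rewrite !real_normK ?num_real // -addrA lerD2l lerDr mulrn_wge0 //.
Qed.

Lemma cmod_sum (I : Type) (s : seq I) (P : pred I) (F : I -> R[i]) :
  cmod (\sum_(i <- s | P i) F i) <= \sum_(i <- s | P i) cmod (F i).
Proof.
apply: (big_ind2 (fun z r => cmod z <= r)); rewrite ?cmod0 //.
by move=> z1 r1 z2 r2 h1 h2; apply: le_trans (cmodD _ _) (lerD h1 h2).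
Qed.

Lemma Re_sum (I : Type) (s : seq I) (P : pred I) (F : I -> R[i]) :
  complex.Re (\sum_(i <- s | P i) F i) = \sum_(i <- s | P i) complex.Re (F i).
Proof. by apply: (big_morph (@complex.Re R)) => // -[? ?] [? ?]. Qed.

Lemma ReM_real z x : complex.Re (z * x%:C) = complex.Re z * x.
Proof. by case: z => ? ? /=; rewrite mulr0 subr0. Qed.

Lemma ImM_real z x : complex.Im (z * x%:C) = complex.Im z * x.
Proof. by case: z => ? ? /=; rewrite mulr0 add0r. Qed.

Definition cexp z : R[i] :=
  (expR (complex.Re z))%:C * (cos (complex.Im z) +i* sin (complex.Im z)).

Lemma cexpE z : cexp z =
  (expR (complex.Re z) * cos (complex.Im z))
    +i* (expR (complex.Re z) * sin (complex.Im z)).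
Proof. by rewrite /cexp; simpc; rewrite /=; congr (_ +i* _);
    rewrite mul0r ?subr0 ?addr0. Qed.

Lemma natpowCE n a : natpowC n a = cexp (a * (ln n%:R)%:C).
Proof. by rewrite /natpowC /cexp ReM_real ImM_real. Qed.

Lemma cexp0 : cexp 0 = 1.
Proof. by rewrite cexpE /= expR0 cos0 sin0 mulr1 mulr0. Qed.

Lemma cexpD z w : cexp (z + w) = cexp z * cexp w.
Proof.
case: z w => [z1 z2] [w1 w2]; rewrite !cexpE /=; simpc.
rewrite expRD cosD sinD; congr (_ +i* _); ring.
Qed.

Lemma cmod_cexp z : cmod (cexp z) = expR (complex.Re z).
Proof.
rewrite /cmod normc_def cexpE /= !exprMn -mulrDr cos2Dsin2 mulr1 sqrtr_sqr.
by rewrite ger0_norm // expR_ge0.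
Qed.

Lemma cexp_real x : cexp x%:C = (expR x)%:C.
Proof. by rewrite cexpE /= cos0 sin0 mulr1 mulr0. Qed.

(** Differentiation is componentwise because the plane is a normed module over
    itself and not over the real line. *)
Definition cderive (f : R -> R[i]) x (l : R[i]) : Prop :=
  is_derive x 1 (fun t => complex.Re (f t)) (complex.Re l) /\
  is_derive x 1 (fun t => complex.Im (f t)) (complex.Im l).

Lemma cderive_cst w x : cderive (fun=> w) x 0.
Proof. by split; exact: is_derive_cst. Qed.

Lemma cderiveD f g x l m : cderive f x l -> cderive g x m ->
  cderive (fun t => f t + g t) x (l + m).
Proof.
move=> [f1 f2] [g1 g2]; split.
- rewrite (_ : complex.Re _ = complex.Re l + complex.Re m);
    last by case: l m {f1 f2 g1 g2} => ? ? [].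
  rewrite (_ : (fun t => _) = (fun t => complex.Re (f t)) + (fun t =>
      complex.Re (g t))).
    exact: is_deriveD.
  by apply/funext => t; rewrite fctE; case: (f t) (g t) => ? ? [].
- rewrite (_ : complex.Im _ = complex.Im l + complex.Im m);
    last by case: l m {f1 f2 g1 g2} => ? ? [].
  rewrite (_ : (fun t => _) = (fun t => complex.Im (f t)) + (fun t =>
      complex.Im (g t))).
    exact: is_deriveD.
  by apply/funext => t; rewrite fctE; case: (f t) (g t) => ? ? [].
Qed.

Lemma cderiveM f g x l m : cderive f x l -> cderive g x m ->
  cderive (fun t => f t * g t) x (l * g x + f x * m).
Proof.
move=> [f1 f2] [g1 g2]; split.
- rewrite (_ : (fun t => _) =
      (fun t => complex.Re (f t)) * (fun t => complex.Re (g t)) -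
      (fun t => complex.Im (f t)) * (fun t => complex.Im (g t))); last first.
    by apply/funext => t; rewrite !fctE /=; case: (f t) (g t) => ? ? [].
  apply: is_derive_eq; rewrite /GRing.scale /=.
  case: l m (f x) (g x) {f1 f2 g1 g2} => ? ? [? ?] [? ?] [? ?] /=; ring.
- rewrite (_ : (fun t => _) =
      (fun t => complex.Re (f t)) * (fun t => complex.Im (g t)) +
      (fun t => complex.Im (f t)) * (fun t => complex.Re (g t))); last first.
    by apply/funext => t; rewrite !fctE /=; case: (f t) (g t) => ? ? [].
  apply: (is_derive_eq (is_deriveD (is_deriveM f1 g2) (is_deriveM f2 g1))).
  rewrite /GRing.scale /=.
  case: l m (f x) (g x) {f1 f2 g1 g2} => ? ? [? ?] [? ?] [? ?] /=; ring.
Qed.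

Lemma cderive_real (g : R -> R) x l : is_derive x 1 g l ->
  cderive (fun t => (g t)%:C) x l%:C.
Proof. by move=> h; split => //=; exact: is_derive_cst. Qed.

Lemma cderive_eq f x l m : cderive f x l -> l = m -> cderive f x m.
Proof. by move=> h <-. Qed.

Lemma cderiveMl w f x l : cderive f x l -> cderive (fun t => w * f t) x (w * l).
Proof.
by move=> h; apply: cderive_eq (cderiveM (cderive_cst w x) h) _; rewrite mul0r add0r.
Qed.

Lemma cderiveB f g x l m : cderive f x l -> cderive g x m ->
  cderive (fun t => f t - g t) x (l - m).
Proof.
move=> hf /(cderiveMl (-1)) hg.
rewrite (_ : (fun t => _) = (fun t => f t + -1 * g t)); last first.
  by apply/funext => t; rewrite mulN1r.
by apply: cderive_eq (cderiveD hf hg) _; rewrite mulN1r.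
Qed.

Lemma cderive_sum n (F : nat -> R -> R[i]) x (l : nat -> R[i]) :
  (forall k, (k < n)%N -> cderive (F k) x (l k)) ->
  cderive (fun t => \sum_(k < n) F k t) x (\sum_(k < n) l k).
Proof.
elim: n => [|n IH] h.
  rewrite big_ord0 (_ : (fun t => _) = fun=> 0); first exact: cderive_cst.
  by apply/funext => t; rewrite big_ord0.
rewrite big_ord_recr (_ : (fun t => _) = fun t => \sum_(k < n) F k t + F n t).
  by apply: cderiveD; [apply: IH => k kn; apply: h; rewrite ltnS ltnW|exact: h].
by apply/funext => t; rewrite big_ord_recr.
Qed.

Lemma cderive_comp f (g : R -> R) x l m : cderive f (g x) l ->
  is_derive x 1 g m -> cderive (fun t => f (g t)) x (l * m%:C).
Proof.
move=> [f1 f2] hg; split; [rewrite ReM_real|rewrite ImM_real].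
- by have := @is_derive1_comp _ (fun t => complex.Re (f t)) g x _ _ f1 hg.
- by have := @is_derive1_comp _ (fun t => complex.Im (f t)) g x _ _ f2 hg.
Qed.

Lemma cderive_cexp a x :
  cderive (fun t => cexp (a * t%:C)) x (a * cexp (a * x%:C)).
Proof.
have mulE c : is_derive x 1 (fun t => c * t) c.
  rewrite (_ : (fun t => c * t) = c *: (@id R)) //.
  by apply: is_derive_eq; rewrite /GRing.scale /= mulr1.
have hE c : is_derive x 1 (fun t => expR (c * t)) (expR (c * x) * c).
  by apply: (@is_derive1_comp _ expR (fun t => c * t)); exact: mulE.
have hC c : is_derive x 1 (fun t => cos (c * t)) (- sin (c * x) * c).
  by apply: (@is_derive1_comp _ cos (fun t => c * t)); exact: mulE.
have hS c : is_derive x 1 (fun t => sin (c * t)) (cos (c * x) * c).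
  by apply: (@is_derive1_comp _ sin (fun t => c * t)); exact: mulE.
split.
- rewrite (_ : (fun t => _) = (fun t => expR (complex.Re a * t)) * (fun t =>
    cos (complex.Im a * t))).
    apply: is_derive_eq; rewrite /GRing.scale /= cexpE ReM_real ImM_real.
    by case: a => ? ? /=; ring.
  by apply/funext => t; rewrite cexpE ReM_real ImM_real.
- rewrite (_ : (fun t => _) = (fun t => expR (complex.Re a * t)) * (fun t =>
    sin (complex.Im a * t))).
    apply: is_derive_eq; rewrite /GRing.scale /= cexpE ReM_real ImM_real.
    by case: a => ? ? /=; ring.
  by apply/funext => t; rewrite cexpE ReM_real ImM_real.
Qed.

Lemma nondecreasing_of_derive (f df : R -> R) x y : x <= y ->
  (forall t, x <= t <= y -> is_derive t 1 f (df t)) ->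
  (forall t, x <= t <= y -> 0 <= df t) -> f x <= f y.
Proof.
rewrite le_eqVlt => /predU1P[->//|xy] fd df0.
have [||c + E] := @MVT R f df x y xy.
- by move=> t; rewrite in_itv /= => /andP[/ltW h1 /ltW h2]; apply: fd; rewrite h1.
- apply: derivable_within_continuous => t; rewrite in_itv /= => h.
  by have [] := fd _ h.
rewrite in_itv /= => /andP[/ltW h1 /ltW h2].
by rewrite -subr_ge0 E mulr_ge0 ?subr_ge0 ?(ltW xy) // df0 // h1.
Qed.

(** Mean value inequality: the real mean value theorem applies once the
    increment of [f] is rotated onto the positive real axis. Taking a function
    [V] instead of a constant bound makes it an estimate of integrals. *)
Lemma cmod_increment_le (f df : R -> R[i]) (V dV : R -> R) x y : x <= y ->
  (forall t, x <= t <= y -> cderive f t (df t)) ->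
  (forall t, x <= t <= y -> is_derive t 1 V (dV t)) ->
  (forall t, x <= t <= y -> cmod (df t) <= dV t) ->
  cmod (f y - f x) <= V y - V x.
Proof.
move=> xy fd Vd dfV; set w := f y - f x; set c := w^*.
have [->|w0] := eqVneq w 0.
  rewrite cmod0 subr_ge0.
  apply: (nondecreasing_of_derive xy Vd) => t xty.
  by apply: le_trans (dfV t xty); exact: cmod_ge0.
have cw : complex.Re (c * w) = cmod w ^+ 2.
  by rewrite cmod_sqr /c; case: (w) => ? ? /=; ring.
have modc : cmod c = cmod w.
  by rewrite /cmod !normc_def /c; case: (w) => ? ? /=; rewrite sqrrN.
have w_gt0 : 0 < cmod w by rewrite lt_def cmod_eq0 w0 cmod_ge0.
pose g t := cmod w * V t - complex.Re (c * f t).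
have gxy : g x <= g y.
  apply: (@nondecreasing_of_derive g (fun t =>
      cmod w * dV t - complex.Re (c * df t))) => // t xty.
  - have [h _] := cderiveMl c (fd t xty).
    have hV := Vd t xty.
    rewrite (_ : g = cmod w *: V - (fun t => complex.Re (c * f t))) //.
    apply: (is_derive_eq (is_deriveB (is_deriveZ _ hV) h)).
    by rewrite /GRing.scale.
  - rewrite subr_ge0; apply: le_trans (ler_norm _) _.
    apply: le_trans (normRe_le_cmod _) _; rewrite cmodM modc.
    by rewrite ler_wpM2l ?cmod_ge0 // dfV.
rewrite -(ler_pM2l w_gt0) -expr2 -cw /w mulrBr.
have -> : complex.Re (c * f y - c * f x) =
    complex.Re (c * f y) - complex.Re (c * f x).
  by case: (c * f y) (c * f x) => ? ? [].
move: gxy; rewrite /g; lra.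
Qed.

End ComplexAnalysis.

Section ComplexLimits.
Variable R : realType.
Implicit Types (a b : R[i]).

Lemma cvg_cmodP (T : Type) (F : set_system T) {FF : Filter F} (f : T -> R[i]) l :
  f @ F --> l <-> forall e : R, 0 < e -> \forall x \near F, cmod (l - f x) < e.
Proof.
split=> [/cvgrPdist_lt fl e e0|h].
  have : 0 < e%:C by rewrite ltcR.
  by move=> /fl; apply: filterS => x; rewrite cmodE ltcR.
apply/cvgrPdist_lt => e; rewrite ltcE /= => /andP[/eqP e1 e0].
have -> : e = (complex.Re e)%:C by case: e e1 {e0} => ? ? /= ->.
by apply: filterS (h _ e0) => x; rewrite cmodE ltcR.
Qed.

Lemma cvg_Re (T : Type) (F : set_system T) {FF : Filter F} (f : T -> R[i]) l :
  f @ F --> l -> (fun x => complex.Re (f x)) @ F --> complex.Re l.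
Proof.
move=> /cvg_cmodP h; apply/cvgrPdist_lt => e /h; apply: filterS => x;
    apply: le_lt_trans.
by apply: le_trans (normRe_le_cmod _); case: l (f x) {h} => ? ? [].
Qed.

Lemma cvg_Im (T : Type) (F : set_system T) {FF : Filter F} (f : T -> R[i]) l :
  f @ F --> l -> (fun x => complex.Im (f x)) @ F --> complex.Im l.
Proof.
move=> /cvg_cmodP h; apply/cvgrPdist_lt => e /h; apply: filterS => x;
    apply: le_lt_trans.
by apply: le_trans (normIm_le_cmod _); case: l (f x) {h} => ? ? [].
Qed.

Lemma cvg_complex (T : Type) (F : set_system T) {FF : Filter F}
    (f g : T -> R) (x y : R) : f @ F --> x -> g @ F --> y ->
  (fun t => f t +i* g t) @ F --> x +i* y.
Proof.
move=> fx gy; apply/cvg_cmodP => e e0.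
have e2 : 0 < e / 2 by rewrite divr_gt0.
have /cvgrPdist_lt /(_ _ e2) h1 := fx.
have /cvgrPdist_lt /(_ _ e2) h2 := gy.
near=> t; apply: le_lt_trans (cmod_le_ReIm _) _ => /=.
rewrite (splitr e) ltrD //; near: t; [exact: h1|exact: h2].
Unshelve. all: by end_near. Qed.

Lemma cvg_cmod (T : Type) (F : set_system T) {FF : Filter F} (f : T -> R[i]) l :
  f @ F --> l -> (fun x => cmod (f x)) @ F --> cmod l.
Proof.
move=> /cvg_cmodP h; apply/cvgrPdist_lt => e /h; apply: filterS => x;
    apply: le_lt_trans.
have := cmodD (l - f x) (f x); have := cmodD (f x - l) l.
rewrite !subrK (cmodB (f x) l) => h1 h2.
by rewrite ler_norml; apply/andP; split; lra.
Qed.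

Lemma cvg_cexp (T : Type) (F : set_system T) {FF : Filter F} (f : T -> R[i]) l :
  f @ F --> l -> (fun t => cexp (f t)) @ F --> cexp l.
Proof.
move=> fl; rewrite cexpE; under eq_fun do rewrite cexpE.
have fR := @cvg_Re _ _ FF _ _ fl; have fI := @cvg_Im _ _ FF _ _ fl.
have hE : (fun t => expR (complex.Re (f t))) @ F --> expR (complex.Re l).
  exact: (cvg_comp _ _ fR (@continuous_expR R _)).
apply: cvg_complex; apply: cvgM => //.
- exact: (cvg_comp _ _ fI (@continuous_cos R _)).
- exact: (cvg_comp _ _ fI (@continuous_sin R _)).
Qed.

Lemma cvg_sumC (T : Type) (F : set_system T) {FF : Filter F} n
    (f : nat -> T -> R[i]) (l : nat -> R[i]) :
  (forall k, (k < n)%N -> f k @ F --> l k) ->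
  (fun t => \sum_(k < n) f k t) @ F --> \sum_(k < n) l k.
Proof.
elim: n => [|n IH] h.
  by rewrite big_ord0; under eq_fun do rewrite big_ord0; exact: cvg_cst.
rewrite big_ord_recr /=; under eq_fun do rewrite big_ord_recr /=.
by apply: cvgD; [apply: IH => k kn; apply: h; rewrite ltnS ltnW|exact: h].
Qed.

Lemma cvg_prodC (T : Type) (F : set_system T) {FF : Filter F} n
    (f : nat -> T -> R[i]) (l : nat -> R[i]) :
  (forall k, (k < n)%N -> f k @ F --> l k) ->
  (fun t => \prod_(k < n) f k t) @ F --> \prod_(k < n) l k.
Proof.
elim: n => [|n IH] h.
  by rewrite big_ord0; under eq_fun do rewrite big_ord0; exact: cvg_cst.
rewrite big_ord_recr /=; under eq_fun do rewrite big_ord_recr /=.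
by apply: cvgM; [apply: IH => k kn; apply: h; rewrite ltnS ltnW|exact: h].
Qed.

Lemma cauchy_cvgn_real (u e : nat -> R) : e @ \oo --> (0 : R) ->
  (forall m k, (m <= k)%N -> `|u k - u m| <= e m) -> cvgn u.
Proof.
move=> e0 ue; apply/cauchy_cvgP/cauchy_exP => r r0.
have /cvgrPdist_lt /(_ _ r0) [m _ /(_ m (leqnn m))] := e0.
rewrite /= sub0r normrN => em; exists (u m); near=> k.
rewrite -ball_normE /= distrC; apply: le_lt_trans (ue m k _) _.
  by near: k; exact: nbhs_infty_ge.
by apply: le_lt_trans em; exact: ler_norm.
Unshelve. all: by end_near. Qed.

Lemma cauchy_cvgn_complex (u : nat -> R[i]) (e : nat -> R) : e @ \oo --> (0 : R) ->
  (forall m k, (m <= k)%N -> cmod (u k - u m) <= e m) -> u @ \oo --> limn u.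
Proof.
move=> e0 ue.
have cR : cvgn (fun n => complex.Re (u n)).
  apply: cauchy_cvgn_real e0 _ => m k mk; apply: le_trans (ue _ _ mk).
  by apply: le_trans (normRe_le_cmod _); case: (u k) (u m) => ? ? [].
have cI : cvgn (fun n => complex.Im (u n)).
  apply: cauchy_cvgn_real e0 _ => m k mk; apply: le_trans (ue _ _ mk).
  by apply: le_trans (normIm_le_cmod _); case: (u k) (u m) => ? ? [].
have uE : u = fun n => complex.Re (u n) +i* complex.Im (u n).
  by apply/funext => n; case: (u n).
have := cvg_complex cR cI; rewrite -uE => h.
exact: cvgP (h _).
Qed.

(** The limit is not given in advance: a locally uniform Cauchy bound provides
    both its existence and its continuity. *)
Lemma continuous_limn (D : set R[i]) (F : nat -> R[i] -> R[i]) :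
  (forall m b, D b -> F m a @[a --> within D (nbhs b)] --> F m b) ->
  (forall b, D b -> exists2 e : nat -> R, e @ \oo --> (0 : R) &
    \forall a \near within D (nbhs b), forall m k, (m <= k)%N ->
      cmod (F k a - F m a) <= e m) ->
  (forall b, D b -> F ^~ b @ \oo --> limn (F ^~ b)) /\
  (forall b, D b -> limn (F ^~ a) @[a --> within D (nbhs b)] --> limn (F ^~ b)).
Proof.
move=> Fc Fu.
have lim_b b : D b -> F ^~ b @ \oo --> limn (F ^~ b).
  move=> Db; have [e e0 he] := Fu b Db.
  apply: cauchy_cvgn_complex e0 _; exact: (nbhs_singleton he Db).
have lim_le e a : D a -> (forall m k, (m <= k)%N -> cmod (F k a - F m a) <= e m) ->
    forall m, cmod (limn (F ^~ a) - F m a) <= e m.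
  move=> Da ha m.
  have h : (fun k => cmod (F k a - F m a)) @ \oo --> cmod (limn (F ^~ a) - F m a).
    by apply: cvg_cmod; apply: cvgB; [exact: lim_b|exact: cvg_cst].
  apply: cvgr_to_le h _; near=> k; apply: ha; near: k; exact: nbhs_infty_ge.
split=> // b Db; have [e e0 he] := Fu b Db.
apply/cvg_cmodP => r r0; have r3 : 0 < r / 3 by rewrite divr_gt0.
have [m em] : exists m, e m < r / 3.
  have /cvgrPdist_lt /(_ _ r3) [m _ /(_ m (leqnn m))] := e0.
  by rewrite /= sub0r normrN => h; exists m; apply: le_lt_trans h; exact: ler_norm.
have /cvg_cmodP /(_ _ r3) hm := Fc m b Db.
near=> a.
have Da : D a by near: a; exact: withinT.
have ha : forall m k, (m <= k)%N -> cmod (F k a - F m a) <= e m by near: a.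
have hma : cmod (F m b - F m a) < r / 3 by near: a.
have h1 := lim_le e a Da ha m.
have h2 := lim_le e b Db (nbhs_singleton he Db) m.
rewrite (_ : limn (F^~ b) - limn (F^~ a) = (limn (F^~ b) - F m b) +
  ((F m b - F m a) + (F m a - limn (F^~ a)))); last by ring.
apply: le_lt_trans (cmodD _ _) _.
apply: le_lt_trans (lerD (lexx _) (cmodD _ _)) _.
rewrite (cmodB (F m a)); lra.
Unshelve. all: by end_near. Qed.

End ComplexLimits.

(** * The law of the size of the tree *)

Section Exploration.
Variable c : seq nat -> nat.
Implicit Types (u v w x : seq nat) (s : seq (seq nat)).

Definition kids v d : seq (seq nat) := [seq rcons v i | i <- iota 0 d].

(** Depth-first exploration with stack [s], which has to stop exactly after
    [n] steps. *)
Fixpoint explore n s : bool :=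
  match n, s with
  | 0%N, _ => nilp s
  | _.+1, [::] => false
  | n'.+1, v :: s' => explore n' (kids v (c v) ++ s')
  end.

Lemma explore_lt n s : (n < size s)%N -> explore n s = false.
Proof.
elim: n s => [[]//|n IH [//|v s] /=]; rewrite ltnS => ns.
by apply: IH; rewrite size_cat (leq_trans ns) // leq_addl.
Qed.

Definition hanging s : set (seq nat) :=
  [set x | exists u w, [/\ u \in s, x = u ++ w & gw_node (fun y => c (u ++ y)) w]].

Definition antichain s :=
  pairwise (fun u v => ~~ prefix u v && ~~ prefix v u) s.

Lemma prefix_rconsE u v i : prefix u (rcons v i) -> prefix u v \/ u = rcons v i.
Proof.
case/prefixP => s; case: (lastP s) => [|s' j]; first by rewrite cats0; right.
by rewrite -rcons_cat => /rcons_inj[-> _]; left; exact: prefix_prefix.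
Qed.

Lemma kidsP v d u : reflect (exists2 i, (i < d)%N & u = rcons v i) (u \in kids v d).
Proof.
apply: (iffP mapP) => -[k]; first by rewrite mem_iota add0n => ? ->; exists k.
by move=> ? ->; exists k => //; rewrite mem_iota add0n.
Qed.

Lemma antichain_kids v d s : antichain (v :: s) -> antichain (kids v d ++ s).
Proof.
rewrite /antichain /= => /andP[vs As]; rewrite pairwise_cat As andbT; apply/andP; split.
  apply/allrelP => u t /kidsP[i _ ->] ts.
  have /andP[vt tv] := allP vs t ts; apply/andP; split.
    by apply: contra vt; apply: prefix_trans; exact: prefix_rcons.
  apply/negP => /prefix_rconsE[h|h]; first by rewrite h in tv.
  by move: vt; rewrite h prefix_rcons.
rewrite pairwise_map; have := iota_uniq 0 d; rewrite uniq_pairwise.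
apply: sub_pairwise => i j /= ij.
by rewrite -!cats1 !prefix_catr // !prefix_cons (eq_sym j) (negbTE ij) andbF.
Qed.

(** The exploration unfolds trees at the root, whereas [gw_node] is defined by
    adding leaves. *)
Lemma gw_node_cons (d : seq nat -> nat) w : gw_node d w <->
  w = [::] \/ exists i w', [/\ w = i :: w', (i < d [::])%N &
                            gw_node (fun y => d (i :: y)) w'].
Proof.
split.
- elim=> [|u i]; first by left.
  move=> du [->|[j [u' [-> jd hu']]]] iu; right.
    by exists i, [::]; split => //; exact: gw_root.
  exists j, (rcons u' i); split => //; apply: gw_child => //.
- move=> [->|[i [w' [-> id_lt]]]]; first exact: gw_root.
  elim=> [|u k hu IH ku]; first by apply: (@gw_child _ [::]) => //; exact: gw_root.
  by rewrite -rcons_cons; exact: gw_child.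
Qed.

Lemma hanging_cons v s :
  hanging (v :: s) = v |` hanging (kids v (c v) ++ s).
Proof.
apply/seteqP; split => x.
- move=> [u [w [+ -> gw]]]; rewrite inE => /predU1P[E|us]; last first.
    by right; exists u, w; rewrite mem_cat us orbT.
  subst u; have [->|[i [w' [-> iv gw']]]] := (gw_node_cons _ w).1 gw.
    by left; rewrite cats0.
  right; exists (rcons v i), w'; split; last 2 first.
  + by rewrite cat_rcons.
  + by under [X in gw_node X]funext do rewrite cat_rcons.
  by rewrite mem_cat; apply/orP; left; apply/kidsP; exists i; rewrite // -[v]cats0.
- move=> [->|[u [w [+ -> gw]]]].
    by exists v, [::]; rewrite mem_head cats0; split => //; exact: gw_root.
  rewrite mem_cat => /orP[/kidsP[i iv E]|us]; last first.
    by exists u, w; rewrite inE us orbT.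
  subst u; exists v, (i :: w); split; [exact: mem_head|by rewrite cat_rcons|].
  apply/gw_node_cons; right; exists i, w; split => //; first by rewrite cats0.
  by under [X in gw_node X]funext do rewrite -cat_rcons.
Qed.

Lemma hanging_kidsN v s :
  antichain (v :: s) -> ~ hanging (kids v (c v) ++ s) v.
Proof.
move=> /= /andP[vs _] [u [w [+ E _]]]; rewrite mem_cat => /orP[/kidsP[i _ Eu]|us].
  have := congr1 size E; rewrite Eu size_cat size_rcons; lia.
have /andP[_] := allP vs u us.
by rewrite E prefix_prefix.
Qed.

Lemma card_setU1_II (T : Type) (A : set T) (x : T) n : ~ A x ->
  (x |` A #= `I_n.+1)%card = (A #= `I_n)%card.
Proof.
move=> Ax; have AE : (x |` A) `\ x = A.
  apply/seteqP; split => y; first by move=> [[->|//] []].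
  by move=> Ay; split; [right|move=> yx; apply: Ax; rewrite -yx].
have up m : (A #= `I_m)%card -> (x |` A #= `I_m.+1)%card.
  by move=> Am; apply/eq_cardSP; exists x; [left|rewrite AE].
apply/idP/idP => [h|]; last exact: up.
have [m Am] : exists m, (A #= `I_m)%card.
  apply/finite_setP; apply: (@sub_finite_set _ _ (x |` A)); first by right.
  by apply/finite_setP; exists n.+1.
have := card_eq_trans (card_esym (up _ Am)) h => /card_eq_II[<-] //.
Qed.

(** The subtrees hanging from an antichain are disjoint, so each step of the
    exploration removes exactly one node. *)
Lemma exploreP n s : antichain s -> explore n s = (hanging s #= `I_n)%card.
Proof.
have h0 : hanging [::] = set0 by apply/seteqP; split => // x [u [w []]].
elim: n s => [|n IH] [|v s] As /=.
- by rewrite h0 II0 card_eq0 eqxx.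
- rewrite II0 card_eq0; apply/esym/negbTE/eqP => /seteqP[+ _].
  by move=> /(_ v); apply; rewrite hanging_cons; left.
- by rewrite h0 card_eq_sym card_eq0;
    apply/esym/negbTE/eqP => /seteqP[+ _] => /(_ 0%N); apply.
- rewrite hanging_cons card_setU1_II; last exact: hanging_kidsN.
  by apply: IH; exact: antichain_kids.
Qed.

Lemma exploreE n : explore n [:: [::]] = (gw_tree c #= `I_n)%card.
Proof.
rewrite exploreP //; congr (_ #= _)%card; apply/seteqP; split => x.
  by move=> [u [w [+ -> gw]]]; rewrite inE => /eqP E; move: gw; rewrite E.
by move=> gx; exists [::], x; rewrite mem_head.
Qed.

End Exploration.

Section TotalProgeny.
Variable R : realType.

(** The probability that a forest of [k] trees has [n] nodes, when [p] is the
    offspring law: exploring the first root, with [i] children, leaves a forest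
    of [i + k.-1] trees and [n.-1] nodes. The bound on [i] loses nothing,
    because a forest has at least as many nodes as trees. *)
Fixpoint forest_pmf (p : nat -> R) n k : R :=
  match n, k with
  | 0%N, 0%N => 1
  | 0%N, _.+1 => 0
  | _.+1, 0%N => 0
  | n'.+1, k'.+1 => \sum_(i < n'.+1) p i * forest_pmf p n' (i + k')%N
  end.

Lemma forest_pmf_lt p n k : (n < k)%N -> forest_pmf p n k = 0.
Proof.
elim: n k => [[]//|n IH [//|k]]; rewrite ltnS => nk /=.
by apply: big1 => i _; rewrite IH ?mulr0 // ltn_addl.
Qed.

Lemma forest_pmf_ge0 p n k : (forall i, 0 <= p i) -> 0 <= forest_pmf p n k.
Proof.
move=> p0; elim: n k => [[]//|n IH [//|k]] /=.
by apply: sumr_ge0 => i _; rewrite mulr_ge0.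
Qed.

Variables (d : measure_display) (T : measurableType d) (P : probability T R).
Variables (N : seq nat -> {RV P >-> nat}) (p : nat -> R).
Hypothesis N_law : forall v i, P (N v @^-1` [set i]) = (p i)%:E.
Hypothesis N_indep : mutually_independent N.

Let count w : seq nat -> nat := fun v => N v w.

Lemma measurable_explore n s : measurable [set w | explore (count w) n s].
Proof.
elim: n s => [|n IH] [|v s] /=.
- by rewrite (_ : mkset _ = setT) //; apply/seteqP; split.
- by rewrite (_ : mkset _ = set0) //; apply/seteqP; split.
- by rewrite (_ : mkset _ = set0) //; apply/seteqP; split.
rewrite (_ : mkset _ = \bigcup_i ((N v @^-1` [set i]) `&`
    [set w | explore (count w) n (kids v i ++ s)])).
  apply: bigcup_measurable => i _; apply: measurableI; last exact: IH.
  exact: measurable_funPTI.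
apply/seteqP; split => w /=; first by exists (N v w).
by move=> [i _ [/= <-]].
Qed.

(** Each step of the exploration reads the number of children of a node that
    was not read before, so it is independent of the explored part [done]. The
    induction needs the joint law with arbitrary values [g] read on [done]. *)
Lemma explore_law n s (done : seq (seq nat)) (g : seq nat -> nat) :
  antichain s -> uniq done ->
  (forall u x, u \in s -> x \in done -> ~~ prefix u x) ->
  P (\bigcap_(x in [set` done]) (N x @^-1` [set g x]) `&`
     [set w | explore (count w) n s]) =
  ((\prod_(x <- done) p (g x)) * forest_pmf p n (size s))%:E.
Proof.
elim: n s done g => [|n IH] [|v s] done g As Ud sd /=.
- rewrite (_ : @mkset T _ = setT); last by apply/seteqP; split.
  rewrite setIT mulr1 N_indep // big_seq; under eq_bigr do rewrite N_law.
  by rewrite -big_seq prodEFin.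
- by rewrite (_ : @mkset T _ = set0) ?setI0 ?measure0 ?mulr0 //; apply/seteqP; split.
- by rewrite (_ : @mkset T _ = set0) ?setI0 ?measure0 ?mulr0 //; apply/seteqP; split.
have vd : v \notin done.
  by apply/negP => vd; have := sd v v (mem_head _ _) vd; rewrite prefix_refl.
pose h i x := if x == v then i else g x.
pose F i := \bigcap_(x in [set` v :: done]) (N x @^-1` [set h i x]) `&`
            [set w | explore (count w) n (kids v i ++ s)].
have hd i x : x \in done -> h i x = g x.
  by rewrite /h; case: eqP => // -> /(negP vd).
have FE : \bigcap_(x in [set` done]) (N x @^-1` [set g x]) `&`
    [set w | explore (count w) n (kids v (N v w) ++ s)] =
    \big[setU/set0]_(i < n.+1) F i.
  rewrite -bigcup_mkord; apply/seteqP; split => w.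
  - move=> [/= gw ew]; exists (N v w).
      rewrite /= ltnS leqNgt; apply/negP => nv; move: ew.
      by rewrite explore_lt // size_cat size_map size_iota ltn_addr.
    split => //= x; rewrite /= inE => /predU1P[->|xd]; first by rewrite /h eqxx.
    by rewrite hd //; exact: gw.
  - move=> [i _ [Fw ew]]; have := Fw v (mem_head _ _); rewrite /= /h eqxx => Nv.
    split; last by rewrite /= Nv.
    by move=> x xd /=; rewrite -(hd i) //; apply: Fw; rewrite /= inE [x \in _]xd orbT.
rewrite FE measure_bigsetU; last 2 first.
- move=> i; apply: measurableI; last exact: measurable_explore.
  apply: fin_bigcap_measurable; first exact: finite_seq.
  by move=> x _; exact: measurable_funPTI.
- apply/trivIsetP => i j _ _ ij; apply/seteqP; split => // w [[Fi _] [Fj _]].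
  have := Fi v (mem_head _ _); have := Fj v (mem_head _ _).
  by rewrite /= /h eqxx => -> ji; rewrite ji eqxx in ij.
rewrite mulr_sumr -sumEFin; apply: eq_bigr => i _.
apply: (etrans (IH (kids v i ++ s) (v :: done) (h i) _ _ _)).
- exact: antichain_kids.
- by rewrite /= vd.
- move=> u x; rewrite mem_cat inE => us /predU1P[->|xd].
    case/orP: us => [/kidsP[j _ ->]|us].
      by apply/negP => /size_prefix; rewrite size_rcons ltnn.
    by case/andP: As => /allP /(_ u us) /andP[_ ].
  case/orP: us => [/kidsP[j _ ->]|us]; last by apply: sd => //; rewrite inE us orbT.
  apply: contra (sd v x (mem_head _ _) xd); apply: prefix_trans; exact: prefix_rcons.
rewrite big_cons {1}/h eqxx size_cat size_map size_iota.
rewrite mulrA [X in X * _]mulrC; congr ((_ * _ * _)%:E).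
rewrite big_seq [RHS]big_seq; apply: eq_bigr => x xd.
by rewrite hd.
Qed.

Lemma progeny_pmfE n : progeny_pmf N n = forest_pmf p n 1.
Proof.
have := @explore_law n [:: [::]] [::] (fun=> 0%N) isT isT.
rewrite big_nil mul1r => E; rewrite /progeny_pmf -[RHS]/(fine (_%:E)).
rewrite -[1%N]/(size [:: [::] : seq nat]) -E //.
congr (fine (P _)); apply/seteqP; split => w /=; rewrite -exploreE; first by [].
by move=> [].
Qed.

End TotalProgeny.

Section GeneratingFunction.
Variables (R : realType) (p : nat -> R).

Lemma forest_pmfSS n k D : (n < D)%N ->
  forest_pmf p n.+1 k.+1 = \sum_(i < D) p i * forest_pmf p n (i + k)%N.
Proof.
move=> nD; rewrite -(subnKC nD) big_split_ord /= [X in _ + X]big1 ?addr0 // => i _.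
by rewrite forest_pmf_lt ?mulr0 //=; lia.
Qed.

Lemma forest_gf_rec n k z D : (n < D)%N ->
  \sum_(m < n.+2) forest_pmf p m k.+1 * z ^+ m =
  z * \sum_(i < D) p i * \sum_(m < n.+1) forest_pmf p m (i + k)%N * z ^+ m.
Proof.
move=> nD; rewrite big_ord_recl [X in X + _]mul0r add0r.
have E (m : 'I_n.+1) : forest_pmf p m.+1 k.+1 * z ^+ m.+1 =
    z * \sum_(i < D) p i * forest_pmf p m (i + k)%N * z ^+ m.
  rewrite (@forest_pmfSS _ _ D); last exact: leq_ltn_trans (leq_ord m) nD.
  by rewrite exprS mulrCA mulr_suml.
rewrite (eq_bigr _ (fun m _ => E m)).
rewrite -mulr_sumr exchange_big /=; congr (_ * _); apply: eq_bigr => i _.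
by rewrite mulr_sumr; apply: eq_bigr => m _; rewrite mulrA.
Qed.

Hypothesis p_ge0 : forall i, 0 <= p i.
Hypothesis p_le1 : forall n, \sum_(i < n) p i <= 1.

(** The powers [u ^+ k] satisfy the recursion of the generating functions of
    forests of [k] trees because [u = z * phi]; only the initial values differ,
    by at most [z], and every step of the recursion multiplies the discrepancy
    by at most [z]. *)
Lemma forest_gf_bounds u z phi :
  (fun n => \sum_(i < n) p i * u ^+ i) @ \oo --> phi -> phi <= 1 ->
  0 <= u <= 1 -> 0 <= z -> u = z * phi ->
  forall n k,
    0 <= u ^+ k - \sum_(m < n.+1) forest_pmf p m k * z ^+ m <= z ^+ n.+1.
Proof.
move=> hphi phi1 /andP[u0 u1] z0 uE.
have phi_ge n : \sum_(i < n) p i * u ^+ i <= phi.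
  apply: cvgr_to_ge hphi _; near=> m.
  have nm : (n <= m)%N by near: m; exact: nbhs_infty_ge.
  rewrite -(subnKC nm) big_split_ord /= lerDl sumr_ge0 // => i _.
  by rewrite mulr_ge0 ?exprn_ge0.
have uz : u <= z by rewrite uE ler_piMr.
elim=> [|n IH] [|k].
- by rewrite big_ord_recl big_ord0 /= mulr1 addr0 subrr lexx expr1.
- rewrite big_ord_recl big_ord0 /= mul0r addr0 subr0 exprn_ge0 //= expr1.
  by apply: le_trans uz; rewrite exprS ler_piMr // exprn_ile1.
- rewrite big_ord_recl big1 /= => [|i _]; last by rewrite mul0r.
  by rewrite mulr1 addr0 subrr lexx exprn_ge0.
have step D : (n < D)%N -> 0 <= \sum_(i < D) p i * u ^+ (i + k) -
    \sum_(i < D) p i * (\sum_(m < n.+1) forest_pmf p m (i + k)%N * z ^+ m) <= z ^+ n.+1.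
  move=> nD; rewrite -sumrB; apply/andP; split.
    apply: sumr_ge0 => i _; rewrite -mulrBr mulr_ge0 //.
    by case/andP: (IH (i + k)%N).
  apply: (@le_trans _ _ (\sum_(i < D) p i * z ^+ n.+1)).
    apply: ler_sum => i _; rewrite -mulrBr ler_wpM2l //.
    by case/andP: (IH (i + k)%N).
  by rewrite -mulr_suml ler_piMl // exprn_ge0.
have limk : (fun D => \sum_(i < D) p i * u ^+ (i + k)) @ \oo --> phi * u ^+ k.
  rewrite (_ : (fun D => _) = (fun D => (\sum_(i < D) p i * u ^+ i) * u ^+ k)).
    by apply: cvgM => //; exact: cvg_cst.
  by apply/funext => D; rewrite mulr_suml; apply: eq_bigr => i _; rewrite exprD mulrA.
set A := \sum_(i < n.+1) p i * (\sum_(m < n.+1) forest_pmf p m (i + k)%N * z ^+ m).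
have AE D : (n < D)%N ->
    \sum_(i < D) p i * (\sum_(m < n.+1) forest_pmf p m (i + k)%N * z ^+ m) = A.
  move=> nD; rewrite -(subnKC nD) big_split_ord /= [X in _ + X]big1 ?addr0 // => i _.
  by rewrite big1 ?mulr0 // => m _; rewrite forest_pmf_lt ?mul0r //;
      have := ltn_ord m; lia.
have lim2 : (fun D => \sum_(i < D) p i * u ^+ (i + k) - A) @ \oo --> phi * u ^+ k - A.
  by apply: cvgB => //; exact: cvg_cst.
have -> : u ^+ k.+1 - \sum_(m < n.+2) forest_pmf p m k.+1 * z ^+ m =
    z * (phi * u ^+ k - A).
  by rewrite (@forest_gf_rec _ _ _ n.+1) // mulrBr mulrA -uE exprS.
apply/andP; split.
  apply: mulr_ge0 => //; apply: cvgr_to_ge lim2 _; near=> D.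
  have nD : (n < D)%N by near: D; exact: nbhs_infty_ge.
  by have /andP[+ _] := step D nD; rewrite AE.
rewrite [leRHS]exprS ler_wpM2l //; apply: cvgr_to_le lim2 _; near=> D.
have nD : (n < D)%N by near: D; exact: nbhs_infty_ge.
by have /andP[_] := step D nD; rewrite AE.
Unshelve. all: by end_near. Qed.

Lemma progeny_gf u z phi :
  (fun n => \sum_(i < n) p i * u ^+ i) @ \oo --> phi -> phi <= 1 ->
  0 <= u <= 1 -> 0 <= z < 1 -> u = z * phi ->
  (fun n => \sum_(m < n) forest_pmf p m 1 * z ^+ m) @ \oo --> u.
Proof.
move=> hphi phi1 u01 /andP[z0 z1] uE.
have z1' : `|z| < 1 by rewrite ger0_norm.
rewrite -cvg_shiftS /=.
have lo : (fun n => u - z ^+ n.+1) @ \oo --> u.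
  rewrite -[X in _ --> X]subr0; apply: cvgB; first exact: cvg_cst.
  by rewrite (cvg_shiftS (fun n => z ^+ n)); exact: cvg_expr.
have hi : (fun n : nat => u) @ \oo --> u by exact: cvg_cst.
apply: squeeze_cvgr lo hi; near=> n.
have := forest_gf_bounds hphi phi1 u01 z0 uE n 1; rewrite expr1; lra.
Unshelve. all: by end_near. Qed.

End GeneratingFunction.

(** * The offspring law *)

Section Moments.
Variables (R : realType) (d : measure_display) (T : measurableType d).
Variables (P : probability T R) (X : {RV P >-> nat}).

Definition law i : R := fine (P (X @^-1` [set i])).

Lemma law_ge0 i : 0 <= law i.
Proof. by rewrite fine_ge0 // measure_ge0. Qed.

Lemma lawE i : P (X @^-1` [set i]) = (law i)%:E.
Proof. by rewrite fineK // fin_num_measure //; exact: measurable_funPTI. Qed.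

Lemma integral_law (h : nat -> R) : (forall i, 0 <= h i) ->
  (\int[P]_w (h (X w))%:E = \sum_(i <oo) (h i * law i)%:E)%E.
Proof.
move=> h0; have -> : [set: T] = \bigcup_i (X @^-1` [set i]).
  by apply/seteqP; split => // w _; exists (X w).
rewrite ge0_integral_bigcup //; last 4 first.
- by move=> i; exact: measurable_funPTI.
- apply/measurable_EFinP; apply: measurable_funTS => _ B mB; rewrite setTI.
  exact: (@measurable_funPTI _ _ _ _ X (h @^-1` B)).
- by move=> w _; rewrite lee_fin.
- by apply/trivIsetP => i j _ _ ij; apply/seteqP; split => // w [/= -> ji];
    rewrite ji eqxx in ij.
apply: eq_eseriesr => i _; rewrite (eq_integral (fun=> (h i)%:E)).
  rewrite integral_cst; last exact: measurable_funPTI.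
  by rewrite EFinM; congr (_ * _)%E; exact: lawE.
by move=> w; rewrite inE /= => ->.
Qed.

Lemma cvg_integral_law (h : nat -> R) l : (forall i, 0 <= h i) ->
  (\int[P]_w (h (X w))%:E = l%:E)%E ->
  (fun n => \sum_(i < n) h i * law i) @ \oo --> l.
Proof.
move=> h0; rewrite integral_law // => E.
have : (fun n => \sum_(0 <= i < n) (h i * law i)%:E)%E @ \oo --> l%:E.
  rewrite -E; apply: is_cvg_nneseries => i _ _.
  by rewrite lee_fin mulr_ge0 // law_ge0.
move=> /fine_cvg; rewrite (_ : _ \o _ = (fun n => \sum_(i < n) h i * law i)) //.
by apply/funext => n /=; rewrite sumEFin big_mkord.
Qed.

Hypothesis X_mean : ('E_P[fun w => (X w)%:R] = 1)%E.
Hypothesis X_var : (0 < 'V_P[fun w => (X w)%:R] < +oo)%E.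

Lemma sum_law : (fun n => \sum_(i < n) law i) @ \oo --> (1 : R).
Proof.
have := @cvg_integral_law (fun=> 1) 1 (fun=> ler01).
rewrite integral_cst //= probability_setT mule1 => /(_ erefl).
rewrite (_ : (fun n => _) = fun n => \sum_(i < n) law i) //.
by apply/funext => n; apply: eq_bigr => i _; rewrite mul1r.
Qed.

Lemma sum_mean_law : (fun n => \sum_(i < n) i%:R * law i) @ \oo --> (1 : R).
Proof. by apply: cvg_integral_law => //; rewrite -X_mean unlock. Qed.

Lemma sum_var_law : (fun n => \sum_(i < n) (i%:R - 1) ^+ 2 * law i) @ \oo -->
  fine 'V_P[fun w => (X w)%:R]%E.
Proof.
apply: (@cvg_integral_law (fun i => (i%:R - 1) ^+ 2)) => [i|]; first exact: sqr_ge0.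
rewrite fineK.
  rewrite /variance !unlock; apply: eq_integral => w _.
  by move: X_mean; rewrite unlock => -> /=; rewrite expr2.
rewrite ge0_fin_numE; first by case/andP: X_var.
by case/andP: X_var => /ltW.
Qed.

(** Otherwise the law lives on positive integers and has mean [1], so it is
    concentrated at [1] and has variance [0]. *)
Lemma law0_gt0 : 0 < law 0.
Proof.
rewrite lt_def law_ge0 andbT; apply/eqP => p0.
have c0 : (fun n => \sum_(i < n) (i%:R - 1) * law i) @ \oo --> (0 : R).
  have -> : (fun n => \sum_(i < n) (i%:R - 1) * law i) =
            (fun n => \sum_(i < n) i%:R * law i - \sum_(i < n) law i).
    by apply/funext => n; rewrite -sumrB; apply: eq_bigr => i _; rewrite mulrBl mul1r.
  rewrite -[X in _ --> X](subrr 1).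
  by apply: cvgB; [exact: sum_mean_law|exact: sum_law].
have t0 i : 0 <= (i%:R - 1) * law i.
  by case: i => [|i]; rewrite ?p0 ?mulr0 // mulr_ge0 ?law_ge0 // subr_ge0 ler1n.
have z0 i : (i%:R - 1) * law i = 0.
  apply/eqP; rewrite eq_le t0 andbT; apply: cvgr_to_ge c0 _; near=> n.
  have ni : (i < n)%N by near: n; exact: nbhs_infty_ge.
  rewrite (bigD1 (Ordinal ni)) //= lerDl sumr_ge0 // => j _; exact: t0.
have := sum_var_law.
rewrite (_ : (fun n => _) = fun=> 0); last first.
  by apply/funext => n; rewrite big1 // => i _; rewrite expr2 -mulrA z0 mulr0.
move=> /cvg_lim; rewrite lim_cst // => /(_ (@Rhausdorff R)) E.
have : (0 < 'V_P[fun w => (X w)%:R])%E by case/andP: X_var.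
have fV : ('V_P[fun w => (X w)%:R])%E \is a fin_num.
  by rewrite ge0_fin_numE; case/andP: X_var => // /ltW.
by rewrite -(fineK fV) -E ltxx.
Unshelve. all: by end_near. Qed.

End Moments.

(** Adding a small linear term makes the function strictly increasing. *)
Lemma derive_ge0_of_nondecreasing (R : realType) (f df : R -> R) (a b x : R) :
  a < x < b ->
  (forall t, a < t < b -> is_derive t 1 f (df t)) ->
  (forall s t, a < s -> s <= t -> t < b -> f s <= f t) -> 0 <= df x.
Proof.
move=> xab fd fm; rewrite -oppr_le0; apply/ler_addgt0Pl => e e0.
rewrite addr0 -subr_ge0 opprK addrC.
have gd t : a < t < b -> is_derive t 1 (f + e *: (@id R)) (df t + e).
  move=> tab; apply: is_derive_eq (is_deriveD (fd t tab)
    (is_deriveZ e (is_derive_id t 1))) _.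
  by rewrite /GRing.scale /= mulr1.
have [_ <-] := gd x xab; rewrite -derive1E.
apply: (@incr_derive1_ge0_itv R _ false true a b x).
- by move=> t; rewrite in_setE /= in_itv /= => /gd[].
- move=> s t; rewrite !in_itv /= => /andP[a1 _] /andP[_ b1] st.
  by rewrite !fctE /= ler_ltD ?ltr_pM2l // fm // ltW.
- by rewrite in_itv.
Qed.

Section CriticalGeneratingFunction.
Variables (R : realType) (p : nat -> R) (W : R).
Hypothesis p_ge0 : forall i, 0 <= p i.
Hypothesis p_sum : (fun n => \sum_(i < n) p i) @ \oo --> (1 : R).
Hypothesis p_mean : (fun n => \sum_(i < n) i%:R * p i) @ \oo --> (1 : R).
Hypothesis p_var : (fun n => \sum_(i < n) (i%:R - 1) ^+ 2 * p i) @ \oo --> W.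

Definition pgf u : R := limn (pseries p u).

Lemma cvg_nneg_series (a : nat -> R) c : (forall i, 0 <= a i) ->
  (forall n, \sum_(i < n) a i <= c) -> cvgn (series a).
Proof.
move=> a0 ac; apply: nondecreasing_is_cvgn.
  apply/nondecreasing_seqP => n; rewrite /series /= big_nat_recr //=.
  by rewrite lerDl.
by exists c => _ [n _ <-]; rewrite /series /= big_mkord.
Qed.

Lemma partial_sum_le (a : nat -> R) l n : (forall i, 0 <= a i) ->
  (fun m => \sum_(i < m) a i) @ \oo --> l -> \sum_(i < n) a i <= l.
Proof.
move=> a0 al; apply: cvgr_to_ge al _; near=> m.
have nm : (n <= m)%N by near: m; exact: nbhs_infty_ge.
by rewrite -(subnKC nm) big_split_ord /= lerDl sumr_ge0.
Unshelve. all: by end_near. Qed.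

Lemma cvg_pgf u : 0 <= u <= 1 ->
  (fun n => \sum_(i < n) p i * u ^+ i) @ \oo --> pgf u.
Proof.
move=> /andP[u0 u1].
rewrite (_ : (fun n => _) = pseries p u); last first.
  by apply/funext => n; rewrite /pseries /series /= big_mkord.
apply: (@cvg_nneg_series _ 1) => [i|n]; first by rewrite mulr_ge0 // exprn_ge0.
apply: le_trans (partial_sum_le n p_ge0 p_sum); apply: ler_sum => i _.
by rewrite ler_piMr // exprn_ile1.
Qed.

Lemma pgf_bounds u : 0 <= u <= 1 -> p 0 <= pgf u <= 1.
Proof.
move=> u01; have /andP[u0 u1] := u01.
have t0 i : 0 <= p i * u ^+ i by rewrite mulr_ge0 // exprn_ge0.
apply/andP; split.
  apply: le_trans (partial_sum_le 1 t0 (cvg_pgf u01)).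
  by rewrite big_ord_recl big_ord0 mulr1 addr0.
apply: ler_cvg_to (cvg_pgf u01) p_sum _; near=> n.
by apply: ler_sum => i _; rewrite ler_piMr // exprn_ile1.
Unshelve. all: by end_near. Qed.

Definition dpgf u : R := limn (pseries (pseries_diffs p) u).

(** Finite variance makes the second derivative converge up to the radius [1],
    hence the generating function is differentiable term by term inside. *)
Lemma cvg_pseries_diffs2 : [/\ cvgn (pseries p 1),
  cvgn (pseries (pseries_diffs p) 1) &
  cvgn (pseries (pseries_diffs (pseries_diffs p)) 1)].
Proof.
split.
- apply: (@cvg_nneg_series _ 1) => [i|n] /=; first by rewrite expr1n mulr1.
  apply: le_trans (partial_sum_le n p_ge0 p_sum).
  by apply: ler_sum => i _; rewrite expr1n mulr1.
- rewrite /pseries_diffs; apply: (@cvg_nneg_series _ 1) => [i|n] /=.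
    by rewrite expr1n mulr1 mulr_ge0.
  have h i : 0 <= i%:R * p i by rewrite mulr_ge0.
  apply: le_trans (partial_sum_le n.+1 h p_mean); rewrite big_ord_recl mul0r add0r.
  by apply: ler_sum => i _; rewrite expr1n mulr1.
- rewrite /pseries_diffs; apply: (@cvg_nneg_series _ (2 * W)) => [i|n] /=.
    by rewrite expr1n mulr1 !mulr_ge0.
  have h i : 0 <= (i%:R - 1) ^+ 2 * p i by rewrite mulr_ge0 ?sqr_ge0.
  have := partial_sum_le n.+2 h p_var; rewrite -(ler_pM2l (@ltr0n R 2)).
  apply: le_trans; rewrite mulr_sumr 2!big_ord_recl addrA ler_wpDl //.
    by rewrite addr_ge0 // mulr_ge0.
  apply: ler_sum => i _; rewrite expr1n mulr1 !lift0 /= !mulrA ler_wpM2r //.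
  rewrite -!natr1; have : 0 <= i%:R :> R by []. 
  nra.
Qed.

Lemma derive_pgf (u : R) : `|u| < 1 -> is_derive u 1 pgf (dpgf u).
Proof.
move=> u1; have [h1 h2 h3] := cvg_pseries_diffs2.
by apply: (pseries_snd_diffs h1 h2 h3); rewrite normr1.
Qed.

Lemma pgf_mono u v : 0 <= u -> u <= v -> v <= 1 -> pgf u <= pgf v.
Proof.
move=> u0 uv v1.
have hu : 0 <= u <= 1 by rewrite u0 (le_trans uv).
have hv : 0 <= v <= 1 by rewrite (le_trans u0).
apply: ler_cvg_to (cvg_pgf hu) (cvg_pgf hv) _; near=> n.
by apply: ler_sum => i _; rewrite ler_wpM2l // lerXn2r ?nnegrE // (le_trans u0).
Unshelve. all: by end_near. Qed.

Lemma dpgf_ge0 u : 0 < u < 1 -> 0 <= dpgf u.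
Proof.
move=> u01; apply: (derive_ge0_of_nondecreasing u01) => [t /andP[t0 t1]|s t s0 st t1].
  by apply: derive_pgf; rewrite gtr0_norm.
by apply: pgf_mono => //; exact: ltW.
Qed.

(** The second order Taylor quotient of [u ^+ k] at [1], as a polynomial with
    nonnegative coefficients, which makes its monotonicity plain. *)
Definition second_quotient k u : R := \sum_(j < k) \sum_(i < j) u ^+ i.

Lemma second_quotientE k u :
  second_quotient k u * (1 - u) ^+ 2 = u ^+ k - 1 - k%:R * (u - 1).
Proof.
rewrite /second_quotient; elim: k => [|k IH].
  by rewrite big_ord0 !mul0r expr0 subrr subr0.
rewrite big_ord_recr /= mulrDl IH.
have h : (\sum_(i < k) u ^+ i) * (1 - u) = 1 - u ^+ k.
  by apply: oppr_inj; rewrite opprB subrX1; ring.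
have -> : (\sum_(i < k) u ^+ i) * (1 - u) ^+ 2 = (1 - u ^+ k) * (1 - u).
  by rewrite -h; ring.
by rewrite -natr1 exprS; ring.
Qed.

Lemma second_quotient_mono k u v : 0 <= u <= v ->
  second_quotient k u <= second_quotient k v.
Proof.
move=> /andP[u0 uv]; apply: ler_sum => j _; apply: ler_sum => i _.
by rewrite lerXn2r ?nnegrE // (le_trans u0).
Qed.

Lemma second_quotient_le k u : 0 <= u <= 1 ->
  second_quotient k u <= (k%:R - 1) ^+ 2.
Proof.
move=> /andP[u0 u1]; elim: k => [|[|k] IH].
- by rewrite /second_quotient big_ord0 sqr_ge0.
- by rewrite /second_quotient big_ord_recl !big_ord0 addr0 sqr_ge0.
rewrite /second_quotient big_ord_recr /=.
have : \sum_(i < k.+1) u ^+ i <= \sum_(i < k.+1) 1.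
  by apply: ler_sum => i _; rewrite exprn_ile1.
rewrite sumr_const card_ord.
move: IH; rewrite /second_quotient -!natr1.
have : 0 <= k%:R :> R by [].
nra.
Qed.

(** The graph of the generating function of a law of mean [1] is tangent to the
    diagonal at [1]; [gap] is the second order quotient there. *)
Definition gap u : R := (pgf u - u) / (1 - u) ^+ 2.

Lemma cvg_gap u : 0 <= u < 1 ->
  (fun n => \sum_(i < n) p i * second_quotient i u) @ \oo --> gap u.
Proof.
move=> /andP[u0 u1].
have u1' : 1 - u != 0 by rewrite subr_eq0 gt_eqF.
have -> : (fun n => \sum_(i < n) p i * second_quotient i u) = (fun n =>
  (\sum_(i < n) p i * u ^+ i - \sum_(i < n) p i
   - (\sum_(i < n) i%:R * p i) * (u - 1)) * (1 - u) ^- 2).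
  apply/funext => n; apply: (mulIf (expf_neq0 2 u1')).
  rewrite mulfVK ?expf_neq0 // -sumrB !mulr_suml -sumrB.
  by apply: eq_bigr => i _; rewrite -[LHS]mulrA second_quotientE; ring.
rewrite /gap (_ : pgf u - u = pgf u - 1 - 1 * (u - 1)); last by ring.
apply: cvgM; last exact: cvg_cst.
apply: cvgB; first by apply: cvgB => //; apply: cvg_pgf; rewrite u0 ltW.
by apply: cvgM => //; exact: cvg_cst.
Qed.

Lemma gap_mono u v : 0 <= u -> u <= v -> v < 1 -> gap u <= gap v.
Proof.
move=> u0 uv v1.
have hu : 0 <= u < 1 by rewrite u0 (le_lt_trans uv).
have hv : 0 <= v < 1 by rewrite (le_trans u0).
apply: ler_cvg_to (cvg_gap hu) (cvg_gap hv) _; near=> n.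
by apply: ler_sum => i _; rewrite ler_wpM2l // second_quotient_mono // u0.
Unshelve. all: by end_near. Qed.

Lemma gap_bounds u : 0 <= u < 1 -> p 0 <= gap u <= W.
Proof.
move=> u01; have /andP[u0 u1] := u01; apply/andP; split.
  apply: le_trans (gap_mono (lexx 0) u0 u1).
  have h01 : (0 : R) <= (0 : R) <= (1 : R) by rewrite lexx ler01.
  have /andP[+ _] := pgf_bounds h01.
  by rewrite /gap !subr0 expr1n divr1.
apply: ler_cvg_to (cvg_gap u01) p_var _; near=> n.
apply: ler_sum => i _; rewrite mulrC ler_wpM2r //.
by apply: second_quotient_le; rewrite u0 ltW.
Unshelve. all: by end_near. Qed.

Definition dgap u : R :=
  (dpgf u - 1) / (1 - u) ^+ 2 + (pgf u - u) * (2 / (1 - u) ^+ 3).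

Lemma derive_gap (u : R) : 0 < u < 1 -> is_derive u 1 gap (dgap u).
Proof.
move=> /andP[u0 u1]; have u1' : 1 - u != 0 by rewrite subr_eq0 gt_eqF.
have hp : is_derive u 1 pgf (dpgf u) by apply: derive_pgf; rewrite gtr0_norm.
have hd : is_derive u 1 (cst 1 - @id R) (0 - 1).
  exact: is_deriveB (is_derive_cst _ _ _) (is_derive_id _ _).
have h2 : ((cst 1 - @id R) * (cst 1 - @id R)) u != 0.
  by rewrite !fctE /= mulf_neq0.
have hg := is_deriveM (is_deriveB hp (is_derive_id u 1))
  (is_deriveV h2 (is_deriveM hd hd)).
have -> : gap = (pgf - @id R) * (fun t => (((cst 1 - @id R) * (cst 1 - @id R)) t)^-1).
  by apply/funext => t; rewrite /gap !fctE expr2.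
apply: is_derive_eq hg _.
rewrite /GRing.scale /= !fctE /= /dgap.
by field.
Qed.

Lemma dgap_ge0 u : 0 < u < 1 -> 0 <= dgap u.
Proof.
move=> u01; apply: (derive_ge0_of_nondecreasing u01 derive_gap) => s t s0 st t1.
by apply: gap_mono => //; exact: ltW.
Qed.

End CriticalGeneratingFunction.

(** * Incomplete beta integrals *)

Section IncompleteBeta.
Variable R : realType.
Implicit Types (a : R[i]) (x z t : R) (n : nat).

Lemma is_derive_exprn n (z : R) : is_derive z 1 (fun t => t ^+ n) (n%:R * z ^+ n.-1).
Proof.
have -> : (fun t => t ^+ n) = (@id R) ^+ n.
  by apply/funext => t; rewrite exprfctE.
apply: is_derive_eq (is_deriveX n (is_derive_id z 1)) _.
by rewrite /GRing.scale /= mulr1.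
Qed.

Lemma is_derive_1B (z : R) : is_derive z 1 (fun t => 1 - t) (-1).
Proof.
have := is_deriveB (is_derive_cst (1 : R) z 1) (is_derive_id z (1 : R)).
by rewrite sub0r.
Qed.

Lemma is_derive_ln1B (z : R) : z < 1 ->
  is_derive z 1 (fun t => ln (1 - t)) (- (1 - z)^-1).
Proof.
move=> z1; have h : 0 < 1 - z by rewrite subr_gt0.
have := @is_derive1_comp _ (@ln R) (fun t =>
    1 - t) z _ _ (is_derive1_ln h) (is_derive_1B z).
by rewrite mulrN1.
Qed.

(** The power [(1 - z) ^ (- a)]. *)
Definition pow1B a z : R[i] := cexp (- a * (ln (1 - z))%:C).

Lemma cmod_pow1B a z : cmod (pow1B a z) = expR (- complex.Re a * ln (1 - z)).
Proof. by rewrite cmod_cexp ReM_real; case: a. Qed.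

Lemma cderive_pow1B a z : z < 1 ->
  cderive (pow1B a) z (a * ((1 - z)^-1)%:C * pow1B a z).
Proof.
move=> z1; have h := @cderive_comp R (fun s => cexp (- a * s%:C))
  (fun t => ln (1 - t)) z _ _ (cderive_cexp (- a) (ln (1 - z))) (is_derive_ln1B z1).
by apply: cderive_eq h _; rewrite -/(pow1B a z) rmorphN /=; ring.
Qed.

(** [incbeta a z n] is the integral of [n t ^ (n - 1) (1 - t) ^ (- a)] over
    [0, z] for [n > 0]; integration by parts gives the recursion. *)
Fixpoint incbeta a z n : R[i] :=
  if n is n'.+1 then
    n%:R / (n%:R - a) * (incbeta a z n' - (z ^+ n' * (1 - z))%:C * pow1B a z)
  else 1.

(** The integral over [0, 1], which converges when [a] has real part less than
    [1]. *)
Definition beta a n : R[i] := \prod_(j < n) (j.+1%:R / (j.+1%:R - a)).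

Lemma betaS a n : beta a n.+1 = n.+1%:R / (n.+1%:R - a) * beta a n.
Proof. by rewrite /beta big_ord_recr [LHS]mulrC. Qed.

Lemma natB_neq0 a n : complex.Re a < 1 -> n.+1%:R - a != 0.
Proof.
move=> a1; apply/eqP => /(congr1 (@complex.Re R)).
rewrite -(rmorph_nat (real_complex R)); case: a a1 => ar ai /= a1.
have : 1 <= n.+1%:R :> R by rewrite ler1n.
lra.
Qed.

Lemma cderive_incbeta a z n : complex.Re a < 1 -> z < 1 ->
  cderive (fun t => incbeta a t n) z ((n%:R * z ^+ n.-1)%:C * pow1B a z).
Proof.
move=> a1 z1; elim: n => [|n IH] /=.
  by rewrite !mul0r; exact: cderive_cst.
have hp : is_derive z 1 (fun t => t ^+ n * (1 - t))
    (n%:R * z ^+ n.-1 * (1 - z) - z ^+ n).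
  have := is_deriveM (is_derive_exprn n z) (is_derive_1B z).
  by move=> h; apply: is_derive_eq h _; rewrite /GRing.scale /=; ring.
apply: cderive_eq (cderiveMl _ (cderiveB IH (cderiveM (cderive_real hp)
  (cderive_pow1B a z1)))) _.
have zn : (n%:R * z ^+ n.-1)%:C * z%:C = (n%:R * z ^+ n)%:C.
  by case: n {IH hp} => [|n]; rewrite -rmorphM /= ?mul0r // exprSr mulrA.
have z1' : (1 - z%:C) != 0 :> R[i].
  by rewrite -(rmorph1 (real_complex R)) -rmorphB /=
      (inj_eq (@complexI R) _ 0) subr_eq0 gt_eqF.
have na := natB_neq0 n a1.
move: zn; rewrite !(rmorphM, rmorphB, rmorphXn, fmorphV, rmorph1, rmorph_nat) /= => zn.
set E := pow1B a z; set u := z%:C in zn z1' *.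
have -> : n%:R * u ^+ n.-1 * E -
   ((n%:R * u ^+ n.-1 * (1 - u) - u ^+ n) * E + u ^+ n * (1 - u) * (a / (1 - u) * E)) =
   (n%:R * u ^+ n.-1 * u) * E + u ^+ n * E - a * u ^+ n * E.
  by field.
by rewrite zn -natr1; move: na; rewrite -natr1 => na; field.
Qed.

Lemma incbetaS a z n : incbeta a z n.+1 =
  n.+1%:R / (n.+1%:R - a) * (incbeta a z n - (z ^+ n * (1 - z))%:C * pow1B a z).
Proof. by []. Qed.

Lemma incbeta0 a n : incbeta a 0 n.+1 = 0.
Proof.
have p0 : pow1B a 0 = 1 by rewrite /pow1B subr0 ln1 rmorph0 mulr0 cexp0.
elim: n => [|n IH]; rewrite incbetaS p0 mulr1 subr0 mulr1.
  by rewrite expr0 rmorph1 subrr mulr0.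
by rewrite IH expr0n rmorph0 subrr mulr0.
Qed.

Lemma ln1B_le0 z : 0 <= z -> ln (1 - z) <= 0.
Proof. by move=> z0; apply: ln_le0; rewrite gerBl. Qed.

Lemma cmod_pow1B_le a z : complex.Re a <= 1 -> 0 <= z < 1 ->
  cmod (pow1B a z) <= (1 - z)^-1.
Proof.
move=> a1 /andP[z0 z1]; rewrite cmod_pow1B.
have z1' : 0 < 1 - z by rewrite subr_gt0.
rewrite -[leRHS](@lnK R) ?posrE ?invr_gt0 // ler_expR lnV ?posrE //.
have := ln1B_le0 z0; nra.
Qed.

Lemma cmod_real_derive n z a : 0 <= z ->
  cmod ((n%:R * z ^+ n.-1)%:C * pow1B a z) =
  n%:R * z ^+ n.-1 * expR (- complex.Re a * ln (1 - z)).
Proof.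
move=> z0; rewrite cmodM cmodR cmod_pow1B ger0_norm //.
by rewrite mulr_ge0 // exprn_ge0.
Qed.

(** The factor [(1 - t) ^ (- a)] of the integrand is at most [(1 - z)^-1]. *)
Lemma cmod_incbeta_le a z n : complex.Re a < 1 -> 0 <= z < 1 ->
  cmod (incbeta a z n.+1) <= z ^+ n.+1 / (1 - z).
Proof.
move=> a1 /andP[z0 z1].
have := @cmod_increment_le R (fun t => incbeta a t n.+1) _
  (fun t => (1 - z)^-1 * t ^+ n.+1) (fun t => (1 - z)^-1 * (n.+1%:R * t ^+ n)) 0 z z0.
rewrite incbeta0 subr0 expr0n mulr0 subr0 mulrC; apply.
- by move=> t /andP[t0 tz]; apply: cderive_incbeta => //; exact: le_lt_trans z1.
- move=> t _; exact: (is_deriveZ _ (is_derive_exprn n.+1 t)).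
move=> t /andP[t0 tz]; have t1 : t < 1 by exact: le_lt_trans z1.
rewrite cmodM cmodR ger0_norm ?mulr_ge0 ?exprn_ge0 // mulrC.
rewrite ler_wpM2r ?mulr_ge0 ?exprn_ge0 //.
apply: le_trans (cmod_pow1B_le (ltW a1) _) _; first by rewrite t0.
by rewrite lef_pV2 ?posrE ?subr_gt0 // lerB.
Qed.

(** The integrand has the modulus of the one for the real part of [a]. *)
Lemma cmod_incbeta_le_real a z n : complex.Re a < 1 -> 0 <= z < 1 ->
  cmod (incbeta a z n.+1) <= complex.Re (incbeta (complex.Re a)%:C z n.+1).
Proof.
move=> a1 /andP[z0 z1].
have := @cmod_increment_le R (fun t => incbeta a t n.+1) _
  (fun t => complex.Re (incbeta (complex.Re a)%:C t n.+1))
  (fun t => complex.Re ((n.+1%:R * t ^+ n)%:C * pow1B (complex.Re a)%:C t)) 0 z z0.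
rewrite !incbeta0 !subr0; apply.
- by move=> t /andP[t0 tz]; apply: cderive_incbeta => //; exact: le_lt_trans z1.
- move=> t /andP[t0 tz].
  have t1 : t < 1 by exact: le_lt_trans z1.
  by have [] := @cderive_incbeta (complex.Re a)%:C t n.+1 a1 t1.
move=> t /andP[t0 tz]; rewrite cmod_real_derive //.
by rewrite /pow1B -rmorphN -rmorphM cexp_real -rmorphM.
Qed.

Lemma beta_real x n : x < 1 ->
  beta x%:C n = (\prod_(j < n) (j.+1%:R / (j.+1%:R - x)))%:C.
Proof.
move=> x1; rewrite rmorph_prod; apply: eq_bigr => j _.
by rewrite rmorphM fmorphV rmorphB !rmorph_nat.
Qed.

Lemma Re_natB_gt0 x n : x < 1 -> 0 < n.+1%:R - x.
Proof. by move=> x1; rewrite subr_gt0 (lt_le_trans x1) // ler1n. Qed.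

Lemma cmod_beta_le a n : complex.Re a < 1 ->
  cmod (beta a n) <= complex.Re (beta (complex.Re a)%:C n).
Proof.
move=> a1; rewrite beta_real //=; elim: n => [|n IH].
  by rewrite /beta !big_ord0 cmod1.
rewrite /beta !big_ord_recr /= cmodM ler_pM ?cmod_ge0 //.
rewrite cmodM cmodV -(rmorph_nat (real_complex R)) cmodR ger0_norm //.
rewrite ler_wpM2l // lef_pV2 ?posrE ?Re_natB_gt0 //.
  by apply: le_trans (ler_norm _) _; apply: le_trans (normRe_le_cmod _); case: (a).
rewrite lt_def cmod_ge0 cmod_eq0 andbT.
by have := natB_neq0 n a1; rewrite -(rmorph_nat (real_complex R)).
Qed.

(** For [j > 1] the factor [j / (j - x)] is at most the square root of
    [j / (j - 1)]. *)
Lemma beta_le_sqrt x n : x <= 2^-1 ->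
  complex.Re (beta x%:C n.+1) <= 2 * Num.sqrt n.+1%:R.
Proof.
move=> x2; have x1 : x < 1 by apply: le_lt_trans x2 _; lra.
rewrite beta_real //=; elim: n => [|n IH].
  rewrite big_ord_recr big_ord0 /= mul1r sqrtr1 mulr1 mul1r.
  by rewrite invf_ple ?posrE ?subr_gt0 //; lra.
rewrite big_ord_recr /=; set P := \prod_(j < n.+1) _ in IH *.
have h := Re_natB_gt0 n.+1 x1.
apply: le_trans (ler_wpM2r _ IH) _; first by rewrite divr_ge0 // ltW.
rewrite -mulrA ler_pM2l // mulrA ler_pdivrMr //.
have s1 := sqrtr_ge0 (n.+1%:R : R); have s2 := sqrtr_ge0 (n.+2%:R : R).
have q1 : Num.sqrt (n.+1%:R : R) ^+ 2 = n.+1%:R by rewrite sqr_sqrtr.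
have q2 : Num.sqrt (n.+2%:R : R) ^+ 2 = n.+2%:R by rewrite sqr_sqrtr.
have : Num.sqrt (n.+1%:R : R) * Num.sqrt n.+2%:R <= n.+2%:R - 2^-1.
  rewrite -ler_sqr ?nnegrE ?mulr_ge0 //; last first.
    by rewrite subr_ge0; apply: (@le_trans _ _ 1); [lra|rewrite ler1n].
  rewrite exprMn q1 q2 -!natr1 -subr_ge0.
  by rewrite (_ : _ - _ = 4^-1) ?invr_ge0 //; field.
set s := Num.sqrt _ in s1 q1 *; set s' := Num.sqrt _ in s2 q2 * => hs.
apply: (@le_trans _ _ ((n.+2%:R - 2^-1) * s')).
  by rewrite -[in leLHS]q2 expr2 mulrA ler_wpM2r.
by rewrite mulrC ler_wpM2l // lerB.
Qed.

Lemma Re_incbeta_le_beta x z n : x < 1 -> 0 <= z < 1 ->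
  complex.Re (incbeta x%:C z n) <= complex.Re (beta x%:C n).
Proof.
move=> x1 /andP[z0 z1]; rewrite beta_real //=; elim: n => [|n IH] /=.
  by rewrite big_ord0.
rewrite big_ord_recr /=.
rewrite (_ : n.+1%:R / (n.+1%:R - x%:C) = (n.+1%:R / (n.+1%:R - x))%:C); last first.
  by rewrite rmorphM fmorphV rmorphB !rmorph_nat.
rewrite [X in complex.Re X]mulrC ReM_real ler_wpM2r //.
  by rewrite divr_ge0 // ltW // Re_natB_gt0.
apply: le_trans IH; rewrite /pow1B -rmorphN -rmorphM cexp_real -rmorphM.
rewrite (_ : complex.Re _ = complex.Re (incbeta x%:C z n) - z ^+ n * (1
    - z) * expR (- x * ln (1 - z))).
  by rewrite gerBl !mulr_ge0 ?exprn_ge0 ?expR_ge0 // subr_ge0 ltW.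
by case: (incbeta x%:C z n).
Qed.

Lemma cvg_expR_ln (t : nat -> R) (c : R) : 0 < c -> (forall m, 0 < t m) ->
  t @ \oo --> (0 : R) -> (fun m => expR (c * ln (t m))) @ \oo --> (0 : R).
Proof.
move=> c0 t0 tl; apply/cvgrPdist_lt => e e0.
have /cvgrPdist_lt /(_ _ (expR_gt0 (ln e / c))) := tl.
apply: filterS => m; rewrite !sub0r !normrN gtr0_norm // gtr0_norm ?expR_gt0 //.
move=> h1; rewrite -[ltRHS](@lnK R) ?posrE // ltr_expR mulrC -ltr_pdivlMr //.
by rewrite -ltr_expR lnK ?posrE.
Qed.

Lemma cvg_incbeta a n (z : nat -> R) : complex.Re a < 1 ->
  (forall m, 0 <= z m < 1) -> (fun m => 1 - z m) @ \oo --> (0 : R) ->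
  (fun m => incbeta a (z m) n) @ \oo --> beta a n.
Proof.
move=> a1 z01 zl; elim: n => [|n IH].
  by rewrite /beta big_ord0; exact: cvg_cst.
rewrite betaS; apply: cvgM; first exact: cvg_cst.
suff h0 : (fun m => (z m ^+ n * (1 - z m))%:C * pow1B a (z m)) @ \oo --> (0 : R[i]).
  by rewrite -[beta a n]subr0; exact: (cvgB IH h0).
apply/cvg_cmodP => e e0.
have z1 m : 0 < 1 - z m by rewrite subr_gt0; case/andP: (z01 m).
have c0 : 0 < 1 - complex.Re a by rewrite subr_gt0.
have /cvgrPdist_lt /(_ _ e0) := cvg_expR_ln c0 z1 zl.
apply: filterS => m; rewrite !sub0r normrN cmodN gtr0_norm ?expR_gt0 //.
apply: le_lt_trans; rewrite cmodM cmodR cmod_pow1B.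
have /andP[z0 z1m] := z01 m.
rewrite ger0_norm; last by rewrite mulr_ge0 ?exprn_ge0 // ltW.
rewrite mulrBl mul1r expRD (@lnK R) ?posrE // -mulNr -mulrA.
by rewrite ler_piMl ?exprn_ile1 ?mulr_ge0 ?expR_ge0 // ltW.
Qed.

Lemma cvg_pow1B (D : set R[i]) z b :
  pow1B a z @[a --> within D (nbhs b)] --> pow1B b z.
Proof.
apply: cvg_cexp; apply: cvgM; last exact: cvg_cst.
by apply: cvgN; exact: cvg_within.
Qed.

Lemma cvg_betaC (D : set R[i]) b n : complex.Re b < 1 ->
  beta a n @[a --> within D (nbhs b)] --> beta b n.
Proof.
move=> b1; apply: (@cvg_prodC R _ _ _ n (fun j a => j.+1%:R / (j.+1%:R - a))
  (fun j => j.+1%:R / (j.+1%:R - b))) => j _.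
apply: cvgM; first exact: cvg_cst.
apply: cvgV; first exact: natB_neq0.
by apply: cvgB; [exact: cvg_cst|exact: cvg_within].
Qed.

Lemma cvg_incbetaC (D : set R[i]) z b n : complex.Re b < 1 ->
  incbeta a z n @[a --> within D (nbhs b)] --> incbeta b z n.
Proof.
move=> b1; elim: n => [|n IH] /=; first exact: cvg_cst.
apply: cvgM; last first.
  suff h : (z ^+ n * (1 - z))%:C * pow1B a z @[a --> within D (nbhs b)] -->
      (z ^+ n * (1 - z))%:C * pow1B b z by exact: (cvgB IH h).
  by apply: cvgM; [exact: cvg_cst|exact: cvg_pow1B].
apply: cvgM; first exact: cvg_cst.
apply: cvgV; first exact: natB_neq0.
by apply: cvgB; [exact: cvg_cst|exact: cvg_within].
Qed.

End IncompleteBeta.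

(** * Continuation up to the line of exponents with real part [1 / 2] *)

Section Continuation.
Variables (R : realType) (q : nat -> R) (A B dA dB : R -> R) (K : R).
Implicit Types (a b : R[i]) (u v : R).

(** When [A] and [B] are the logarithms of [gap] and of the generating function
    [Phi], this is [u / Phi u]. Only monotonicity and boundedness of [A] and [B]
    matter below. *)
Definition gf_inverse u : R := 1 - (1 - u) ^+ 2 * expR (A u - B u).
Local Notation Z := gf_inverse.

Hypothesis q_ge0 : forall n, 0 <= q n.
Hypothesis q0 : q 0 = 0.
Hypothesis Z_ge0 : forall u, 0 < u < 1 -> 0 <= Z u.
Hypothesis gfZ : forall u, 0 < u < 1 ->
  (fun M => \sum_(n < M) q n * Z u ^+ n) @ \oo --> u.
Hypothesis A_derive : forall u : R, 0 < u < 1 -> is_derive u 1 A (dA u).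
Hypothesis B_derive : forall u : R, 0 < u < 1 -> is_derive u 1 B (dB u).
Hypothesis dA_ge0 : forall u, 0 < u < 1 -> 0 <= dA u.
Hypothesis dB_ge0 : forall u, 0 < u < 1 -> 0 <= dB u.
Hypothesis A_bound : forall u, 0 < u < 1 -> `|A u| <= K.
Hypothesis B_bound : forall u, 0 < u < 1 -> `|B u| <= K.

Let between u v w : 0 < u < 1 -> 0 < v < 1 -> u <= w <= v -> 0 < w < 1.
Proof. by move=> /andP[u0 _] /andP[_ v1] /andP[uw wv]; apply/andP; split; lra. Qed.

Lemma Z_lt1 u : u < 1 -> Z u < 1.
Proof. by move=> u1; rewrite gtrBl mulr_gt0 ?expR_gt0 // exprn_gt0 ?subr_gt0. Qed.

Lemma Z01 u : 0 < u < 1 -> 0 <= Z u < 1.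
Proof. by move=> u01; rewrite Z_ge0 //= Z_lt1 //; case/andP: u01. Qed.

Lemma ln1BZ u : u < 1 -> ln (1 - Z u) = 2 * ln (1 - u) + (A u - B u).
Proof.
move=> u1; have u1' : 0 < 1 - u by rewrite subr_gt0.
rewrite /Z opprB addrC subrK lnM ?posrE ?exprn_gt0 ?expR_gt0 //.
by rewrite lnXn // expRK mulr_natl.
Qed.

(** By [gfZ], the map [Z] is a right inverse of the nondecreasing generating
    function of [q]. *)
Lemma Z_mono u v : 0 < u < 1 -> 0 < v < 1 -> u <= v -> Z u <= Z v.
Proof.
move=> u01 v01; rewrite le_eqVlt => /predU1P[->//|uv].
rewrite leNgt; apply/negP => ZZ; move: uv; rewrite ltNge => /negP; apply.
apply: ler_cvg_to (gfZ v01) (gfZ u01) _; near=> M.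
apply: ler_sum => n _; rewrite ler_wpM2l // lerXn2r ?nnegrE ?Z_ge0 //.
exact: ltW.
Unshelve. all: by end_near. Qed.

(** The tails of the generating function of [q], written as a difference so that
    they can be differentiated without differentiating a series. *)
Definition tailgf M u := u - \sum_(n < M) q n * Z u ^+ n.

Lemma cvg_tailgf M u : 0 < u < 1 ->
  (fun k => \sum_(n < k) q (M + n)%N * Z u ^+ (M + n)) @ \oo --> tailgf M u.
Proof.
move=> u01; rewrite /tailgf.
pose S k := \sum_(n < k) q n * Z u ^+ n.
have h : [sequence S (k + M)%N]_k @ \oo --> u by rewrite cvg_shiftn; exact: gfZ.
rewrite (_ : (fun k => _) = (fun k => S (k + M)%N - S M)).
  by apply: cvgB => //; exact: cvg_cst.
by apply/funext => k; rewrite /S (addnC k M) big_split_ord /= [RHS]addrC addKr.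
Qed.

Lemma tailgf_ge0 M u : 0 < u < 1 -> 0 <= tailgf M u.
Proof.
move=> u01; apply: cvgr_to_ge (@cvg_tailgf M _ u01) _; near=> k.
by apply: sumr_ge0 => n _; rewrite mulr_ge0 // exprn_ge0 // Z_ge0.
Unshelve. all: by end_near. Qed.

Lemma tailgf_mono M u v : 0 < u < 1 -> 0 < v < 1 -> u <= v ->
  tailgf M u <= tailgf M v.
Proof.
move=> u01 v01 uv; apply: ler_cvg_to (@cvg_tailgf M _ u01) (@cvg_tailgf M _ v01) _.
near=> k; apply: ler_sum => n _; rewrite ler_wpM2l //.
by rewrite lerXn2r ?nnegrE ?Z_ge0 // Z_mono.
Unshelve. all: by end_near. Qed.

Lemma cvg_tailgf0 u : 0 < u < 1 -> (fun M => tailgf M u) @ \oo --> (0 : R).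
Proof.
by move=> u01; rewrite -(subrr u); apply: cvgB; [exact: cvg_cst|exact: gfZ].
Qed.

Definition dZ u := (1 - Z u) * (2 / (1 - u) - dA u + dB u).

Lemma Z_derive u : 0 < u < 1 -> is_derive u 1 Z (dZ u).
Proof.
move=> u01; have /andP[_ u1] := u01.
have hd := is_derive_1B u.
have hAB := is_deriveB (A_derive u01) (B_derive u01).
have hE := @is_derive1_comp _ expR (A - B) u _ _ (is_derive_expR _) hAB.
have h := is_deriveB (is_derive_cst (1 : R) u 1) (is_deriveM (is_deriveM hd hd) hE).
have -> : Z = cst 1 - (fun t => 1 - t) * (fun t => 1 - t) * (fun t => expR ((A - B) t)).
  by apply/funext => t; rewrite !fctE /Z expr2.
apply: is_derive_eq h _; rewrite /GRing.scale /= !fctE /= /dZ /Z.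
have : 1 - u != 0 by rewrite subr_eq0 gt_eqF.
by move=> ?; field.
Qed.

Definition dtailgf M u := 1 - \sum_(n < M) q n * (n%:R * Z u ^+ n.-1 * dZ u).

Lemma tailgf_derive M u : 0 < u < 1 -> is_derive u 1 (tailgf M) (dtailgf M u).
Proof.
move=> u01; rewrite /dtailgf.
have h n : is_derive u 1 (fun t => q n * Z t ^+ n) (q n * (n%:R * Z u ^+ n.-1 * dZ u)).
  have h1 := @is_derive1_comp _ (fun t => t ^+ n) Z u _ _
    (is_derive_exprn n (Z u)) (Z_derive u01).
  by apply: is_derive_eq (is_deriveZ (q n) h1) _.
have -> : tailgf M = @id R - \sum_(n < M) (fun t => q n * Z t ^+ n).
  by apply/funext => t; rewrite !fctE /tailgf fct_sumE.
exact: is_deriveB (is_derive_id _ _) (is_derive_sum (fun i => h i)).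
Qed.

Lemma dtailgf_ge0 M u : 0 < u < 1 -> 0 <= dtailgf M u.
Proof.
move=> u01; apply: (derive_ge0_of_nondecreasing u01 (tailgf_derive M)).
move=> s t s0 st t1; apply: tailgf_mono => //; apply/andP; split; lra.
Qed.

(** By substitution, [power_integral a u] is the integral of
    [(1 - Z s) ^ (- a)] for [s] between [0] and [u], and
    [power_integral_sum a M u] the contribution of the first [M] terms of the
    generating function of [q]. *)
Definition power_integral_sum a M u := \sum_(n < M) (q n)%:C * incbeta a (Z u) n.
Definition power_integral a u : R[i] := limn (fun M => power_integral_sum a M u).

(** The boundary term of the integration by parts: its derivative would be
    [(1 - Z u) ^ (- a)] if [A] and [B] were constant. *)
Definition leading_part a u := - (1 - u)%:C * pow1B a (Z u) / (1 - 2 * a).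

Definition remainder a u := power_integral a u - leading_part a u.

Definition left_plane : set R[i] := [set a | complex.Re a <= 2^-1].
Definition punctured_plane : set R[i] := left_plane `\ (2^-1 : R[i]).

Lemma left_plane_lt1 a : left_plane a -> complex.Re a < 1.
Proof. by rewrite /left_plane /= => h; apply: le_lt_trans h _; lra. Qed.

Lemma punctured_plane_of_lt a : complex.Re a < 2^-1 -> punctured_plane a.
Proof.
move=> a2; split; first exact: ltW.
move=> /= aE; move: a2; rewrite aE.
by rewrite -(rmorph_nat (real_complex R)) -fmorphV /= ltxx.
Qed.

Lemma punctured_plane_neq0 a : punctured_plane a -> 1 - 2 * a != 0.
Proof.
move=> [_ /= ha]; apply/eqP => h; apply: ha.
have two0 : (2 : R[i]) != 0 by rewrite pnatr_eq0.
by apply: (mulfI two0); rewrite mulfV //; apply/eqP; rewrite eq_sym -subr_eq0 h.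
Qed.

Lemma cmod_term_le a u n : left_plane a -> 0 < u < 1 ->
  cmod ((q n)%:C * incbeta a (Z u) n) <= (1 - Z u)^-1 * (q n * Z u ^+ n).
Proof.
move=> aD u01; case: n => [|n]; first by rewrite q0 !mul0r mulr0 cmod0.
rewrite cmodM cmodR ger0_norm // mulrCA ler_wpM2l // mulrC.
by apply: cmod_incbeta_le; [exact: left_plane_lt1|exact: Z01].
Qed.

Lemma power_integral_sum_tail a u m k : left_plane a -> 0 < u < 1 -> (m <= k)%N ->
  cmod (power_integral_sum a k u - power_integral_sum a m u) <=
      (1 - Z u)^-1 * tailgf m u.
Proof.
move=> aD u01 mk; rewrite -(subnKC mk) /power_integral_sum big_split_ord /=
    addrAC subrr add0r.
apply: le_trans (cmod_sum _ _ _) _.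
have iz : 0 <= (1 - Z u)^-1 by rewrite invr_ge0 subr_ge0 ltW //; case/andP: (Z01 u01).
apply: (@le_trans _ _ ((1 - Z u)^-1 *
    \sum_(n < k - m) q (m + n)%N * Z u ^+ (m + n))).
  by rewrite mulr_sumr; apply: ler_sum => n _; exact: cmod_term_le.
have t0 n : 0 <= q (m + n)%N * Z u ^+ (m + n).
  by rewrite mulr_ge0 // exprn_ge0 // Z_ge0.
rewrite ler_wpM2l //; exact: (partial_sum_le (k - m) t0 (@cvg_tailgf m _ u01)).
Qed.

Lemma power_integral_cvg u : 0 < u < 1 ->
  (forall a, left_plane a -> (fun M => power_integral_sum a M u) @ \oo -->
      power_integral a u) /\
  (forall b, left_plane b ->
    power_integral a u @[a --> within left_plane (nbhs b)] --> power_integral b u).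
Proof.
move=> u01; apply: (@continuous_limn R left_plane (fun M a =>
    power_integral_sum a M u)).
  move=> M b bD; apply: (@cvg_sumC R _ _ _ M (fun n a => (q n)%:C * incbeta a (Z u) n)
    (fun n => (q n)%:C * incbeta b (Z u) n)) => n _.
  by apply: cvgM; [exact: cvg_cst|apply: cvg_incbetaC; exact: left_plane_lt1].
move=> b bD; exists (fun M => (1 - Z u)^-1 * tailgf M u).
  rewrite -[X in _ --> X](mulr0 (1 - Z u)^-1).
  by apply: cvgM; [exact: cvg_cst|exact: cvg_tailgf0].
near=> a; move=> m k mk; apply: power_integral_sum_tail => //; near: a; exact: withinT.
Unshelve. all: by end_near. Qed.

(** [(1 - u) (1 - Z u) ^ (- a)] is [(1 - u) ^ (1 - 2 a)] up to a bounded
    factor. *)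
Lemma weighted_pow1B_le a u : 0 < u < 1 ->
  (1 - u) * cmod (pow1B a (Z u)) <=
  expR ((1 - 2 * complex.Re a) * ln (1 - u)) * expR (2 * K * cmod a).
Proof.
move=> u01; have /andP[u0 u1] := u01.
have u1' : 0 < 1 - u by rewrite subr_gt0.
rewrite cmod_pow1B ln1BZ // -{1}[1 - u](@lnK R) ?posrE // -!expRD ler_expR.
set x := complex.Re a; set l := ln (1 - u).
rewrite (_ : l + - x * (2 * l + (A u - B u)) = (1 - 2 * x) * l + - x * (A u - B u));
    last by ring.
rewrite lerD2l; apply: le_trans (ler_norm _) _; rewrite normrM normrN mulrC.
apply: ler_pM => //; last exact: normRe_le_cmod.
by apply: le_trans (ler_normB _ _) _; rewrite mulr_natl mulr2n lerD ?A_bound ?B_bound.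
Qed.

Lemma weighted_pow1B_bounded a u : left_plane a -> 0 < u < 1 ->
  (1 - u) * cmod (pow1B a (Z u)) <= expR (2 * K * cmod a).
Proof.
move=> aD u01; apply: le_trans (weighted_pow1B_le a u01) _.
rewrite ler_piMl ?expR_ge0 // -[leRHS]expR0 ler_expR.
apply: mulr_ge0_le0; last by apply: ln1B_le0; case/andP: u01 => /ltW.
by move: aD; rewrite /left_plane /= => aD; lra.
Qed.

Definition increment_const a := cmod a / cmod (1 - 2 * a) * expR (2 * K * cmod a).

Lemma increment_const_ge0 a : 0 <= increment_const a.
Proof. by rewrite mulr_ge0 ?expR_ge0 // divr_ge0 ?cmod_ge0. Qed.

Lemma cderive_leading_part a u : 0 < u < 1 -> punctured_plane a ->
  cderive (leading_part a) u (pow1B a (Z u) +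
    a / (1 - 2 * a) * ((1 - u)%:C * pow1B a (Z u)) * (dA u - dB u)%:C).
Proof.
move=> u01 aD; have /andP[u0 u1] := u01.
have h1 := cderive_comp (cderive_pow1B a (Z_lt1 u1)) (Z_derive u01).
have h2 := cderiveMl (- (1 - 2 * a)^-1) (cderiveM (cderive_real (is_derive_1B u)) h1).
have -> : leading_part a = fun t => - (1 - 2 * a)^-1 * ((1 - t)%:C * pow1B a (Z t)).
  by apply/funext => t; rewrite /leading_part !mulNr [in RHS]mulrC.
apply: cderive_eq h2 _.
have a0 := punctured_plane_neq0 aD.
have Zn : 1 - Z u != 0 by rewrite subr_eq0 gt_eqF // Z_lt1.
have un : 1 - u != 0 by rewrite subr_eq0 gt_eqF.
have eZ : ((1 - Z u)^-1)%:C * (dZ u)%:C * (1 - u)%:C =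
    (2 - (1 - u) * (dA u - dB u))%:C.
  by rewrite -!rmorphM /dZ; congr (_%:C); field; rewrite un Zn.
rewrite [LHS](_ : _ = - (1 - 2 * a)^-1 * pow1B a (Z u) * ((-1)%:C + a *
  (((1 - Z u)^-1)%:C * (dZ u)%:C * (1 - u)%:C))); last by ring.
rewrite eZ !(rmorphB, rmorphM, rmorphN, rmorph1, rmorph_nat) /=.
by field.
Qed.

Lemma cderive_power_integral_sum a M u : 0 < u < 1 -> left_plane a ->
  cderive (power_integral_sum a M) u ((1 - dtailgf M u)%:C * pow1B a (Z u)).
Proof.
move=> u01 aD; have /andP[u0 u1] := u01.
have h n : cderive (fun t => (q n)%:C * incbeta a (Z t) n) u
    ((q n * (n%:R * Z u ^+ n.-1 * dZ u))%:C * pow1B a (Z u)).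
  have h1 := cderive_comp (@cderive_incbeta R a (Z u) n (left_plane_lt1 aD) (Z_lt1 u1))
    (Z_derive u01).
  apply: cderive_eq (cderiveMl (q n)%:C h1) _.
  by rewrite (rmorphM _ (q n)) (rmorphM _ _ (dZ u)) /=; ring.
apply: cderive_eq (@cderive_sum R M (fun n t => (q n)%:C * incbeta a (Z t) n) u _
  (fun n _ => h n)) _.
by rewrite -mulr_suml -rmorph_sum /dtailgf /= opprB addrC subrK.
Qed.

(** The derivative of [power_integral_sum a M - leading_part a] has two parts:
    one is controlled by the variation of [A] and [B], the other by the
    derivative of the tail of the generating function, which is nonnegative, so
    that its integral is at most the tail itself and disappears as [M] grows. *)
Lemma remainder_increment a u v : punctured_plane a -> 0 < u < 1 ->
  0 < v < 1 -> u <= v ->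
  cmod (remainder a v - remainder a u) <=
      increment_const a * ((A v + B v) - (A u + B u)).
Proof.
move=> aD u01 v01 uv; have aL : left_plane a by case: aD.
(* [kap] bounds [(1 - Z t) ^ (- a)] on [u, v]; it multiplies
   tails that tend to [0]. *)
pose kap := (1 - Z v)^-1.
pose f M t := power_integral_sum a M t - leading_part a t.
pose V M t := increment_const a * (A t + B t) + kap * tailgf M t.
have step M : cmod (f M v - f M u) <= V M v - V M u.
  apply: (@cmod_increment_le R (f M) (fun t => (1 - dtailgf M t)%:C * pow1B a (Z t) -
    (pow1B a (Z t) + a / (1 - 2 * a) * ((1 - t)%:C * pow1B a (Z t)) * (dA t - dB t)%:C))
    (V M) (fun t => increment_const a * (dA t + dB t) + kap * dtailgf M t) u v uv) =>
        t utv.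
  - have t01 := between u01 v01 utv.
    by apply: cderiveB; [exact: cderive_power_integral_sum|exact: cderive_leading_part].
  - have t01 := between u01 v01 utv.
    have h := is_deriveD (is_deriveZ (increment_const a) (is_deriveD (A_derive t01) (B_derive t01)))
      (is_deriveZ kap (tailgf_derive M t01)).
    by apply: is_derive_eq h _; rewrite /GRing.scale.
  have t01 := between u01 v01 utv; have /andP[t0 t1] := t01.
  have hP1 := weighted_pow1B_bounded aL t01.
  have hP2 := cmod_pow1B_le (ltW (left_plane_lt1 aL)) (Z01 t01).
  move: (pow1B a (Z t)) hP1 hP2 => P hP1 hP2.
  rewrite (_ : _ - _ = - ((dtailgf M t)%:C * P +
      a / (1 - 2 * a) * ((1 - t)%:C * P) * (dA t - dB t)%:C)); last first.
    by rewrite rmorphB rmorph1; ring.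
  rewrite cmodN; apply: le_trans (cmodD _ _) _; rewrite addrC.
  apply: lerD.
    rewrite !cmodM !cmodR /increment_const cmodV (ger0_norm (_ : 0 <= 1 - t)); last lra.
    rewrite -[leLHS]mulrA -[leRHS]mulrA.
    apply: ler_wpM2l; first by rewrite divr_ge0 ?cmod_ge0.
    apply: ler_pM => //; first by apply: mulr_ge0; [lra|exact: cmod_ge0].
    by apply: le_trans (ler_normB _ _) _; rewrite !ger0_norm ?dA_ge0 ?dB_ge0.
  rewrite cmodM cmodR ger0_norm ?dtailgf_ge0 // mulrC.
  apply: ler_wpM2r; first exact: dtailgf_ge0.
  apply: le_trans hP2 _.
  have /andP[_ tv] := utv.
  have Zv1 : Z v < 1 by apply: Z_lt1; case/andP: v01.
  have Zt1 := Z_lt1 t1; have Ztv := Z_mono t01 v01 tv.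
  by rewrite /kap lef_pV2 ?posrE ?subr_gt0 // lerB.
have lhs : (fun M => cmod (f M v - f M u))
    @ \oo --> cmod (remainder a v - remainder a u).
  apply: cvg_cmod; apply: cvgB; apply: cvgB; try exact: cvg_cst.
  - by have [h _] := power_integral_cvg v01; exact: h.
  - by have [h _] := power_integral_cvg u01; exact: h.
have rhs : (fun M => V M v - V M u) @ \oo -->
    (increment_const a * (A v + B v) + kap * 0)
        - (increment_const a * (A u + B u) + kap * 0).
  apply: cvgB; apply: cvgD; try exact: cvg_cst; apply: cvgM; try exact: cvg_cst.
    exact: cvg_tailgf0.
  exact: cvg_tailgf0.
rewrite mulr0 !addr0 in rhs.
by rewrite mulrBr; apply: ler_cvg_to lhs rhs _; near=> M; exact: step.
Unshelve. all: by end_near. Qed.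

Definition to_one m : R := 1 - m.+2%:R^-1.

Lemma to_one01 m : 0 < to_one m < 1.
Proof.
rewrite /to_one subr_gt0 gtrBl invr_gt0 ltr0n andbT.
by rewrite invf_lt1 ?ltr0n // ltr1n.
Qed.

Lemma to_one_mono m k : (m <= k)%N -> to_one m <= to_one k.
Proof. by move=> mk; rewrite /to_one lerB // lef_pV2 ?posrE ?ltr0n // ler_nat !ltnS. Qed.

Lemma cvg_1B_to_one : (fun m => 1 - to_one m) @ \oo --> (0 : R).
Proof.
rewrite (_ : (fun m => _) = [sequence (@harmonic R) (m + 1)%N]_m).
  by rewrite cvg_shiftn; exact: cvg_harmonic.
by apply/funext => m; rewrite /to_one /harmonic /= subKr addn1.
Qed.

Lemma AB_mono m k : (m <= k)%N -> A (to_one m) + B (to_one m) <=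
    A (to_one k) + B (to_one k).
Proof.
move=> mk; apply: (@nondecreasing_of_derive R (A + B) (fun t =>
    dA t + dB t) _ _ (to_one_mono mk)).
  move=> t ht; have t01 := between (to_one01 m) (to_one01 k) ht.
  exact: is_deriveD (A_derive t01) (B_derive t01).
by move=> t ht; have t01 := between (to_one01 m) (to_one01 k) ht;
    rewrite addr_ge0 ?dA_ge0 ?dB_ge0.
Qed.

Definition ABsup : R := limn (fun m => A (to_one m) + B (to_one m)).

Lemma cvg_AB : (fun m => A (to_one m) + B (to_one m)) @ \oo --> ABsup.
Proof.
apply: nondecreasing_is_cvgn; first exact: AB_mono.
exists (K + K) => _ [m _ <-]; apply: lerD.
  by apply: le_trans (ler_norm _) _; exact: A_bound (to_one01 m).
by apply: le_trans (ler_norm _) _; exact: B_bound (to_one01 m).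
Qed.

Lemma AB_le_sup m : A (to_one m) + B (to_one m) <= ABsup.
Proof. by apply: nondecreasing_cvgn_le; [exact: AB_mono|exact: cvg_AB]. Qed.

Lemma cvg_punctured_id b : (a @[a --> within punctured_plane (nbhs b)] --> b).
Proof. exact: cvg_within. Qed.

Lemma cvg_12a b : (1 - 2 * a @[a --> within punctured_plane (nbhs b)] --> 1 - 2 * b).
Proof.
apply: cvgB; first exact: cvg_cst.
by apply: cvgM; [exact: cvg_cst|exact: cvg_punctured_id].
Qed.

Lemma cvg_increment_const b : punctured_plane b -> increment_const a @[a -->
    within punctured_plane (nbhs b)] --> increment_const b.
Proof.
move=> bD; have hb := cvg_cmod (@cvg_punctured_id b).
apply: cvgM.
  apply: cvgM; first exact: hb.
  apply: cvgV; first by rewrite cmod_eq0; exact: punctured_plane_neq0.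
  exact: cvg_cmod (@cvg_12a b).
have h : 2 * K * cmod a @[a --> within punctured_plane (nbhs b)] --> 2 * K * cmod b.
  by apply: cvgM; [exact: cvg_cst|exact: hb].
exact: (cvg_comp _ _ h (@continuous_expR R _)).
Qed.

Lemma cvg_leading_partC u b : punctured_plane b ->
  leading_part a u @[a --> within punctured_plane (nbhs b)] --> leading_part b u.
Proof.
move=> bD; apply: cvgM.
  by apply: cvgM; [exact: cvg_cst|exact: cvg_pow1B].
by apply: cvgV; [exact: punctured_plane_neq0|exact: cvg_12a].
Qed.

Definition limit_remainder a : R[i] := limn (fun m => remainder a (to_one m)).

(** The bounded increasing sequence [A (to_one m) + B (to_one m)] is Cauchy, and by
    [remainder_increment] it controls the remainders, with a constant that
    depends continuously on the exponent. *)
Lemma limit_remainder_cvg :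
  (forall a, punctured_plane a -> (fun m => remainder a (to_one m)) @ \oo -->
      limit_remainder a) /\
  (forall b, punctured_plane b -> limit_remainder a @[a -->
      within punctured_plane (nbhs b)] --> limit_remainder b).
Proof.
apply: (@continuous_limn R punctured_plane (fun m a => remainder a (to_one m))).
  move=> m b bD; suff h : power_integral a (to_one m) @[a -->
      within punctured_plane (nbhs b)] --> power_integral b (to_one m).
    exact: (cvgB h (@cvg_leading_partC (to_one m) b bD)).
  have sub (S : set R[i]) :
      within left_plane (nbhs b) S -> within punctured_plane (nbhs b) S.
    by apply: (@filterS _ (nbhs b)) => a aS [aL _]; exact: aS.
  have [_ h] := power_integral_cvg (to_one01 m); have bL : left_plane b by case: bD.
  by move=> S hS; apply: sub; exact: (h b bL S hS).
move=> b bD; exists (fun m => (increment_const b + 1) * (ABsup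
    - (A (to_one m) + B (to_one m)))).
  rewrite -[X in _ --> X](mulr0 (increment_const b + 1)); apply: cvgM;
      first exact: cvg_cst.
  by rewrite -(subrr ABsup); apply: cvgB; [exact: cvg_cst|exact: cvg_AB].
have hr : \forall a \near within punctured_plane (nbhs b), increment_const a < increment_const b + 1.
  by apply: (cvgr_lt _ (@cvg_increment_const b bD)); rewrite ltrDl.
near=> a; move=> m k mk.
have aD : punctured_plane a by near: a; exact: withinT.
apply: le_trans (remainder_increment aD (to_one01 m) (to_one01 k) (to_one_mono mk)) _.
apply: ler_pM; [exact: increment_const_ge0|by rewrite subr_ge0 AB_mono| |].
  by apply: ltW; near: a.
by rewrite lerD2r AB_le_sup.
Unshelve. all: by end_near. Qed.

Lemma cvg_leading_part0 a : complex.Re a < 2^-1 ->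
  (fun m => leading_part a (to_one m)) @ \oo --> (0 : R[i]).
Proof.
move=> a2; have c0 : 0 < 1 - 2 * complex.Re a by lra.
pose C := expR (2 * K * cmod a) / cmod (1 - 2 * a).
have t0 m : 0 < 1 - to_one m by rewrite subr_gt0; case/andP: (to_one01 m).
have h := cvg_expR_ln c0 t0 cvg_1B_to_one.
have hC : (fun m => expR ((1 - 2 * complex.Re a) * ln (1 - to_one m)) * C) @ \oo -->
    (0 : R).
  by rewrite -(mul0r C); apply: cvgM; [exact: h|exact: cvg_cst].
apply/cvg_cmodP => e e0; have /cvgrPdist_lt /(_ _ e0) := hC.
apply: filterS => m; rewrite !sub0r normrN cmodN; apply: le_lt_trans.
apply: le_trans (ler_norm _); rewrite /leading_part mulNr mulNr cmodN 2!cmodM cmodV cmodR.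
rewrite ger0_norm; last exact: ltW (t0 m).
rewrite /C mulrA; apply: ler_wpM2r; first by rewrite invr_ge0 cmod_ge0.
exact: weighted_pow1B_le (to_one01 m).
Qed.

Lemma cvg_1BZ : (fun m => 1 - Z (to_one m)) @ \oo --> (0 : R).
Proof.
have h0 : (fun m => (1 - to_one m) * (1 - to_one m) * expR (K + K)) @ \oo --> (0 : R).
  rewrite -(mul0r (expR (K + K))) -[X in X * _](mul0r (0 : R)).
  by apply: cvgM; [apply: cvgM; exact: cvg_1B_to_one|exact: cvg_cst].
apply: (@squeeze_cvgr _ _ _ _ (fun=> 0) _ _ _ _ _ h0); last exact: cvg_cst.
near=> m; have /andP[_ u1] := to_one01 m.
have hZ := Z_lt1 u1; rewrite subr_ge0 ltW //=.
rewrite /Z opprB addrC subrK -expr2 ler_wpM2l ?sqr_ge0 // ler_expR.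
apply: le_trans (ler_norm _) _; apply: le_trans (ler_normB _ _) _.
by rewrite lerD ?A_bound ?B_bound ?to_one01.
Unshelve. all: by end_near. Qed.

Lemma coef_sum_le1 M : \sum_(n < M) q n <= 1.
Proof.
have hZ : (fun m => Z (to_one m)) @ \oo --> (1 : R).
  rewrite -[X in _ --> X]subr0 (_ : (fun m => Z (to_one m)) =
      fun m => 1 - (1 - Z (to_one m))).
    by apply: cvgB; [exact: cvg_cst|exact: cvg_1BZ].
  by apply/funext => m; rewrite subKr.
have h : (fun m => \sum_(n < M) q n * Z (to_one m) ^+ n) @ \oo --> \sum_(n < M) q n.
  elim: M => [|M IH].
    by rewrite big_ord0; under eq_fun do rewrite big_ord0; exact: cvg_cst.
  rewrite big_ord_recr /=; under eq_fun do rewrite big_ord_recr /=.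
  apply: cvgD; first exact: IH.
  rewrite -[X in _ --> X]mulr1 -[X in _ * X](expr1n R M); apply: cvgM.
    exact: cvg_cst.
  exact: (cvg_comp _ _ hZ (@exprn_continuous R M 1)).
apply: cvgr_to_le h _; near=> m.
have /andP[_ /ltW u1] := to_one01 m; apply: le_trans u1.
rewrite -subr_ge0; exact: tailgf_ge0 (to_one01 m).
Unshelve. all: by end_near. Qed.

(** Dominated convergence in [m], with the terms [q n * beta x n] as dominating
    sequence, where [x] is the real part of [a]. They are summable because the
    real partial sums are positive and bounded by the limit of the integrals. *)
Lemma cvg_sum_beta a : complex.Re a < 2^-1 ->
  (fun M => \sum_(n < M) (q n)%:C * beta a n) @ \oo --> limit_remainder a.
Proof.
move=> a2; set x := complex.Re a.
have aD := punctured_plane_of_lt a2;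
    have xD : punctured_plane x%:C by exact: punctured_plane_of_lt.
have a1 : x < 1 by apply: left_plane_lt1; case: aD.
have pintE w : complex.Re w < 2^-1 -> (fun m =>
    power_integral w (to_one m)) @ \oo --> limit_remainder w.
  move=> w2; have [h _] := limit_remainder_cvg.
  have -> : (fun m => power_integral w (to_one m)) =
      (fun m => remainder w (to_one m) + leading_part w (to_one m)).
    by apply/funext => m; rewrite /remainder subrK.
  rewrite -[limit_remainder w]addr0.
  exact: (cvgD (h w (punctured_plane_of_lt w2)) (@cvg_leading_part0 w w2)).
have psumE w M : complex.Re w < 1 -> (fun m =>
    power_integral_sum w M (to_one m)) @ \oo -->
    \sum_(n < M) (q n)%:C * beta w n.
  move=> w1; apply: (@cvg_sumC R _ _ _ M (fun n m =>
      (q n)%:C * incbeta w (Z (to_one m)) n)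
    (fun n => (q n)%:C * beta w n)) => n _.
  apply: cvgM; first exact: cvg_cst.
  by apply: cvg_incbeta => // [m|]; [exact: Z01 (to_one01 m)|exact: cvg_1BZ].
have ReqM (c : R) (w : R[i]) : complex.Re (c%:C * w) = c * complex.Re w.
  by rewrite mulrC ReM_real mulrC.
pose bn n := complex.Re (beta x%:C n).
have bn_ge0 n : 0 <= bn n.
  rewrite /bn beta_real //; apply: prodr_ge0 => j _.
  by rewrite divr_ge0 // ltW // Re_natB_gt0.
have dominated u n : 0 < u < 1 ->
    cmod ((q n)%:C * incbeta a (Z u) n) <= q n * bn n.
  move=> u01; case: n => [|n]; first by rewrite q0 !mul0r cmod0.
  rewrite cmodM cmodR ger0_norm //; apply: ler_wpM2l => //.
  apply: le_trans (cmod_incbeta_le_real n a1 (Z01 u01)) _.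
  exact: Re_incbeta_le_beta (Z01 u01).
pose T M := \sum_(n < M) q n * bn n.
have T_le M : T M <= complex.Re (limit_remainder x%:C).
  have lhs := cvg_Re (psumE x%:C M a1); have rhs := cvg_Re (pintE x%:C a2).
  have -> : T M = complex.Re (\sum_(n < M) (q n)%:C * beta x%:C n).
    by rewrite Re_sum; apply: eq_bigr => n _; rewrite ReqM.
  apply: ler_cvg_to (lhs _) (rhs _) _; near=> m.
  have [h _] := power_integral_cvg (to_one01 m).
  have hk := cvg_Re (h x%:C (ltW a2)).
  apply: cvgr_to_ge (hk _) _; near=> k.
  have Mk : (M <= k)%N by near: k; exact: nbhs_infty_ge.
  rewrite /power_integral_sum !Re_sum -(subnKC Mk) big_split_ord /= lerDl.
  apply: sumr_ge0 => n _; rewrite ReqM.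
  case: (M + n)%N => [|j]; first by rewrite q0 mul0r.
  rewrite mulr_ge0 //.
  exact: le_trans (cmod_ge0 _) (@cmod_incbeta_le_real R x%:C _ j a1 (Z01 (to_one01 m))).
have qb_ge0 n : 0 <= q n * bn n by rewrite mulr_ge0.
have Tcvg : T @ \oo --> limn T.
  rewrite (_ : T = series (fun n => q n * bn n)).
    exact: (cvg_nneg_series qb_ge0 T_le).
  by apply/funext => M; rewrite /T /series /= big_mkord.
have T_lim M : T M <= limn T by exact: (partial_sum_le M qb_ge0 Tcvg).
have tail M m : cmod (power_integral a (to_one m)
    - power_integral_sum a M (to_one m)) <= limn T - T M.
  have [h _] := power_integral_cvg (to_one01 m).
  have hk : (fun k => cmod (power_integral_sum a k (to_one m)
      - power_integral_sum a M (to_one m))) @ \oo -->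
      cmod (power_integral a (to_one m) - power_integral_sum a M (to_one m)).
    by apply: cvg_cmod; apply: cvgB; [exact: h a (ltW a2)|exact: cvg_cst].
  apply: cvgr_to_le hk _; near=> k.
  have Mk : (M <= k)%N by near: k; exact: nbhs_infty_ge.
  apply: (@le_trans _ _ (T k - T M)); last by rewrite lerD2r.
  rewrite /T /power_integral_sum -(subnKC Mk) !big_split_ord /=
      addrAC subrr add0r addrAC subrr add0r.
  apply: le_trans (cmod_sum _ _ _) _; apply: ler_sum => n _.
  exact: dominated (to_one01 m).
have bound M : cmod (limit_remainder a - \sum_(n < M) (q n)%:C * beta a n) <=
    limn T - T M.
  have h : (fun m => cmod (power_integral a (to_one m)
      - power_integral_sum a M (to_one m))) @ \oo -->
      cmod (limit_remainder a - \sum_(n < M) (q n)%:C * beta a n).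
    by apply: cvg_cmod; apply: cvgB; [exact: pintE|exact: psumE].
  by apply: cvgr_to_le h _; near=> m; exact: tail.
have T0 : (fun M => limn T - T M) @ \oo --> (0 : R).
  by rewrite -(subrr (limn T)); apply: cvgB => //; exact: cvg_cst.
apply/cvg_cmodP => e e0; have /cvgrPdist_lt /(_ _ e0) := T0.
apply: filterS => M; rewrite sub0r normrN; apply: le_lt_trans.
exact: le_trans (bound M) (ler_norm _).
Unshelve. all: by end_near. Qed.

End Continuation.

(** * From beta values to powers *)

Section Powers.
Variable R : realType.
Implicit Types (a b : R[i]).

(** The quotient of [n ^ a] by [beta a n], without the poles of [beta]. *)
Definition pow_ratio n a : R[i] := natpowC n a * \prod_(j < n) (1 - a / j.+1%:R).

Lemma pow_ratioE n a : complex.Re a < 1 -> pow_ratio n a * beta a n = natpowC n a.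
Proof.
move=> a1; rewrite /pow_ratio /beta -mulrA -big_split /= big1 ?mulr1 // => j _.
have h := natB_neq0 j a1; have h' : j.+1%:R != 0 :> R[i] by rewrite pnatr_eq0.
by field; rewrite !nat1r h h'.
Qed.

Definition ratio_step a s : R[i] := pow1B a s * (1 - a * s%:C).

Lemma pow_ratioS n a : (0 < n)%N ->
  pow_ratio n.+1 a = pow_ratio n a * ratio_step a (n.+1%:R)^-1.
Proof.
move=> n0; rewrite /pow_ratio big_ord_recr /= /ratio_step !natpowCE fmorphV rmorph_nat.
suff -> : cexp (a * (ln n.+1%:R)%:C) =
    cexp (a * (ln n%:R)%:C) * pow1B a (n.+1%:R)^-1 by ring.
rewrite /pow1B -cexpD mulNr -mulrBr -rmorphB; congr (cexp (_ * _%:C)).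
have -> : 1 - n.+1%:R^-1 = n%:R / n.+1%:R :> R.
  by rewrite -natr1; field; rewrite natr1 pnatr_eq0.
rewrite ln_div ?posrE ?ltr0n //; ring.
Qed.

Definition step_const a : R := 2 * cmod a * cmod (1 - a).

(** The derivative of [ratio_step a] vanishes at [0]: this is where the increments
    of [pow_ratio] get their order [n ^ (- 2)]. *)
Lemma ratio_step_le a s : complex.Re a <= 1 -> 0 <= s <= 2^-1 ->
  cmod (ratio_step a s - 1) <= step_const a * s ^+ 2.
Proof.
move=> a1 /andP[s0 s2].
have step0 : ratio_step a 0 = 1.
  by rewrite /ratio_step /pow1B subr0 ln1 rmorph0 !mulr0 cexp0 subr0 mulr1.
have := @cmod_increment_le R (ratio_step a)
  (fun t => a * (1 - a) * (t / (1 - t))%:C * pow1B a t)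
  (fun t => step_const a * t ^+ 2) (fun t => step_const a * (2 * t)) 0 s s0.
rewrite step0 expr0n mulr0 subr0; apply.
- move=> t /andP[t0 ts]; have t1 : t < 1 by lra.
  have h := cderiveM (cderive_pow1B a t1) (cderiveB (cderive_cst 1 t)
    (cderiveMl a (cderive_real (is_derive_id t (1 : R))))).
  apply: cderive_eq h _.
  have t1' : 1 - t%:C != 0 :> R[i].
    by rewrite -(rmorph1 (real_complex R)) -rmorphB /=
        (inj_eq (@complexI R) _ 0) subr_eq0 gt_eqF.
  rewrite !(rmorphM, fmorphV, rmorphB, rmorph1) /=.
  by field.
- move=> t _; have h := is_deriveZ (step_const a) (is_derive_exprn 2 t).
  by apply: is_derive_eq h _; rewrite expr1.
move=> t /andP[t0 ts]; have t1 : t < 1 by lra.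
have hP := @cmod_pow1B_le R a t a1.
move: (pow1B a t) hP => P hP; have {}hP : cmod P <= 2.
  apply: le_trans (hP _) _; first by rewrite t0.
  by rewrite invf_ple ?posrE ?subr_gt0 //; lra.
have tt : 0 <= t / (1 - t) by rewrite divr_ge0 // subr_ge0 ltW.
rewrite !cmodM cmodR ger0_norm //.
rewrite (_ : step_const a * (2 * t) = cmod a * cmod (1 - a) * (2 * t) * 2); last first.
  by rewrite /step_const; ring.
have ca : 0 <= cmod a * cmod (1 - a) by rewrite mulr_ge0 ?cmod_ge0.
apply: ler_pM => //; [exact: mulr_ge0|exact: cmod_ge0|].
apply: ler_wpM2l; first by rewrite mulr_ge0 ?cmod_ge0.
rewrite mulrC; apply: ler_wpM2r => //.
by rewrite invf_ple ?posrE ?subr_gt0 //; lra.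
Qed.

Lemma step_const_ge0 a : 0 <= step_const a.
Proof. by rewrite !mulr_ge0 ?cmod_ge0. Qed.

Lemma step_range n : 0 <= (n.+2%:R : R)^-1 <= 2^-1.
Proof. by rewrite invr_ge0 ler0n lef_pV2 ?posrE ?ltr0n // ler_nat. Qed.

Definition ratio_bound a : R := cmod (1 - a) * expR (step_const a).

Lemma pow_ratio_le n a : complex.Re a <= 1 ->
  cmod (pow_ratio n.+1 a) <= ratio_bound a.
Proof.
move=> a1.
suff h : cmod (pow_ratio n.+1 a) <=
    cmod (1 - a) * expR (step_const a * (1 - n.+1%:R^-1)).
  apply: le_trans h _; rewrite ler_wpM2l ?cmod_ge0 // ler_expR ler_piMr ?step_const_ge0 //.
elim: n => [|n IH].
  rewrite /pow_ratio natpowCE ln1 mulr0 cexp0 mul1r big_ord_recr big_ord0 /= mul1r.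
  by rewrite divr1 invr1 subrr mulr0 expR0 mulr1.
rewrite pow_ratioS // cmodM.
have hs := ratio_step_le a1 (step_range n).
apply: (@le_trans _ _ (cmod (1 - a) * expR (step_const a * (1 - n.+1%:R^-1)) *
    expR (step_const a * (n.+2%:R^-1) ^+ 2))).
  apply: ler_pM => //; rewrite ?cmod_ge0 //.
  apply: le_trans (expR_ge1Dx _).
  rewrite -{1}[ratio_step _ _](subrK 1); apply: le_trans (cmodD _ _) _.
  by rewrite cmod1 addrC lerD2l.
rewrite -mulrA -expRD ler_wpM2l ?cmod_ge0 // ler_expR -mulrDr.
apply: ler_wpM2l; first exact: step_const_ge0.
(* 1 / m ^ 2 <= 1 / (m - 1) - 1 / m *)
have n1 : 0 < n.+1%:R :> R by rewrite ltr0n.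
rewrite -[n.+2%:R]natr1; move: (n.+1%:R : R) n1 => x x0.
rewrite -subr_ge0 (_ : _ - _ = x^-1 * (x + 1)^-1 ^+ 2).
  by rewrite mulr_ge0 ?sqr_ge0 // invr_ge0 ltW.
by field; rewrite !gt_eqF //; lra.
Qed.

Lemma pow_ratio_diff n a : complex.Re a <= 1 ->
  cmod (pow_ratio n.+2 a - pow_ratio n.+1 a) <=
  ratio_bound a * step_const a * (n.+2%:R^-1) ^+ 2.
Proof.
move=> a1; rewrite pow_ratioS // -{2}[pow_ratio n.+1 a]mulr1 -mulrBr cmodM -mulrA.
apply: ler_pM; rewrite ?cmod_ge0 ?pow_ratio_le //.
exact: ratio_step_le (step_range n).
Qed.

(** Growth like the square root against increments of order [n ^ (- 2)]. *)
Lemma telescope_sqrt (N : nat) : (0 < N)%N ->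
  Num.sqrt (N%:R : R) * (N.+1%:R^-1) ^+ 2 <=
  2 * ((Num.sqrt N%:R)^-1 - (Num.sqrt N.+1%:R)^-1).
Proof.
move=> N0; have s0 : 0 < Num.sqrt (N%:R : R) by rewrite sqrtr_gt0 ltr0n.
have s1 : 0 < Num.sqrt (N.+1%:R : R) by rewrite sqrtr_gt0 ltr0n.
have q0 : Num.sqrt (N%:R : R) ^+ 2 = N%:R by rewrite sqr_sqrtr.
have q1 : Num.sqrt (N.+1%:R : R) ^+ 2 = N.+1%:R by rewrite sqr_sqrtr.
have q01 : Num.sqrt (N.+1%:R : R) ^+ 2 = Num.sqrt N%:R ^+ 2 + 1 by rewrite q0 q1 natr1.
suff key (s t : R) : 0 < s -> 0 < t -> t ^+ 2 = s ^+ 2 + 1 ->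
    s * ((t ^+ 2)^-1) ^+ 2 <= 2 * (s^-1 - t^-1).
  by have := key _ _ s0 s1 q01; rewrite q1.
move=> {}s0 t0 h.
rewrite -subr_ge0.
have s0' := ltW s0; have t0' := ltW t0.
have st : s <= t by rewrite -ler_sqr ?nnegrE // h lerDl.
rewrite [leRHS](_ : _ = (2 * (t - s) * t ^+ 3 - s ^+ 2) / (s * t ^+ 4)); last first.
  by field; rewrite !gt_eqF.
rewrite divr_ge0 ?mulr_ge0 ?exprn_ge0 // subr_ge0.
have h1 : (t - s) * (t + s) = 1 by rewrite -subr_sqr h; ring.
have h2 : 1 <= 2 * (t - s) * t.
  rewrite (_ : _ * t = (t - s) * (t + s) + (t - s) ^+ 2); last by ring.
  by rewrite h1 lerDl sqr_ge0.
apply: (@le_trans _ _ (1 * t ^+ 2)); first by rewrite mul1r ler_sqr ?nnegrE.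
by rewrite [t ^+ 3]exprS [leRHS]mulrA ler_wpM2r ?exprn_ge0.
Qed.

Lemma cvg_sqrtV : (fun m => (Num.sqrt (m.+1%:R : R))^-1) @ \oo --> (0 : R).
Proof.
apply/cvgrPdist_lt => e e0.
have h : (fun n => n.+1%:R^-1) @ \oo --> (0 : R) := @cvg_harmonic R.
have /cvgrPdist_lt /(_ _ (exprn_gt0 2 e0)) := h.
apply: filterS => m; rewrite !sub0r !normrN !gtr0_norm ?invr_gt0 ?sqrtr_gt0 ?ltr0n //.
move=> hm; rewrite -ltr_sqr ?nnegrE ?invr_ge0 ?sqrtr_ge0 ?(ltW e0) //.
by rewrite exprVn sqr_sqrtr.
Qed.

Variables (q : nat -> R) (L : R[i] -> R[i]).
Hypothesis q_ge0 : forall n, 0 <= q n.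
Hypothesis q0 : q 0 = 0.
Hypothesis q_le1 : forall M, \sum_(n < M) q n <= 1.
Hypothesis L_cvg : forall b, punctured_plane b -> L a @[a -->
    within (@punctured_plane R) (nbhs b)] --> L b.
Hypothesis L_sum : forall a, complex.Re a < 2^-1 ->
  (fun M => \sum_(n < M) (q n)%:C * beta a n) @ \oo --> L a.

Let S a M := \sum_(n < M) (q n)%:C * beta a n.
Let P a M := \sum_(n < M) natpowC n a * (q n)%:C.

(** Partial sums of the series of [q n * n ^ a], corrected by the tail of the
    series of [q n * beta a n]. On the line where the latter need not converge,
    the continued value [L a] stands for its sum. *)
Definition corrected_sum M a := P a M.+2 + pow_ratio M.+1 a * (L a - S a M.+2).

(** Summation by parts: the terms of the two series cancel and only the increment
    of [pow_ratio] remains. *)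
Lemma corrected_sumS M a : complex.Re a < 1 ->
  corrected_sum M.+1 a - corrected_sum M a =
  (pow_ratio M.+2 a - pow_ratio M.+1 a) * (L a - S a M.+2).
Proof.
move=> a1; rewrite /corrected_sum /P /S.
rewrite big_ord_recr [X in L a - X]big_ord_recr /= -(pow_ratioE M.+2 a1).
set p := \sum_(i < M.+2) _; set s := \sum_(i < M.+2) _.
ring.
Qed.

Lemma cmod_S_le M a : left_plane a -> cmod (S a M.+2) <= 2 * Num.sqrt M.+1%:R.
Proof.
move=> aL; have a1 := left_plane_lt1 aL.
apply: le_trans (cmod_sum _ _ _) _.
apply: (@le_trans _ _ (\sum_(n < M.+2) q n * (2 * Num.sqrt M.+1%:R))); last first.
  by rewrite -mulr_suml ler_piMl // mulr_ge0.
apply: ler_sum => -[[|n] nM] _ /=; first by rewrite q0 !mul0r cmod0.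
rewrite cmodM cmodR ger0_norm //; apply: ler_wpM2l => //.
apply: le_trans (cmod_beta_le _ a1) _; apply: le_trans (beta_le_sqrt _ aL) _.
by rewrite ler_pM2l // ler_sqrt ?ltr0n // ler_nat.
Qed.

Definition sum_const a : R := ratio_bound a * step_const a * (cmod (L a) + 2).

Lemma sum_const_ge0 a : 0 <= sum_const a.
Proof.
by rewrite !mulr_ge0 ?step_const_ge0 ?cmod_ge0 ?expR_ge0 // addr_ge0 ?cmod_ge0.
Qed.

Lemma corrected_sum_diff m k a : left_plane a -> (m <= k)%N ->
  cmod (corrected_sum k a - corrected_sum m a) <=
  sum_const a * (2 * (Num.sqrt m.+1%:R)^-1).
Proof.
move=> aL mk.
have a1 : complex.Re a < 1 := left_plane_lt1 aL.
pose g j : R := (Num.sqrt j.+1%:R)^-1.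
suff h : cmod (corrected_sum k a - corrected_sum m a) <=
    sum_const a * (2 * (g m - g k)).
  apply: le_trans h _; apply: ler_wpM2l; first exact: sum_const_ge0.
  by rewrite ler_pM2l // gerBl invr_ge0 sqrtr_ge0.
elim: k mk => [|k IH]; first by rewrite leqn0 => /eqP ->; rewrite !subrr cmod0 !mulr0.
rewrite leq_eqVlt => /predU1P[->|]; first by rewrite !subrr cmod0 !mulr0.
rewrite ltnS => /IH {}IH.
have -> : corrected_sum k.+1 a - corrected_sum m a =
  (corrected_sum k.+1 a - corrected_sum k a) + (corrected_sum k a - corrected_sum m a).
  by ring.
have -> : sum_const a * (2 * (g m - g k.+1)) =
   sum_const a * (2 * (g k - g k.+1)) + sum_const a * (2 * (g m - g k)) by ring.
apply: le_trans (cmodD _ _) (lerD _ IH).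
rewrite corrected_sumS // cmodM.
have s1 : 1 <= Num.sqrt (k.+1%:R : R) by rewrite -[leLHS]sqrtr1 ler_sqrt ?ler1n.
have h1 : cmod (L a - S a k.+2) <= (cmod (L a) + 2) * Num.sqrt k.+1%:R.
  apply: le_trans (cmodD _ _) _; rewrite cmodN mulrDl lerD ?cmod_S_le //.
  by rewrite ler_peMr ?cmod_ge0.
apply: le_trans (ler_pM (cmod_ge0 _) (cmod_ge0 _) (pow_ratio_diff k (ltW a1)) h1) _.
rewrite [leLHS](_ : _ = sum_const a * (Num.sqrt k.+1%:R * (k.+2%:R^-1) ^+ 2));
    last first.
  by rewrite /sum_const; ring.
by apply: ler_wpM2l; [exact: sum_const_ge0|exact: telescope_sqrt].
Qed.

Lemma cvg_natpowC n b :
  natpowC n a @[a --> within (@punctured_plane R) (nbhs b)] --> natpowC n b.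
Proof.
rewrite natpowCE; under eq_fun do rewrite natpowCE.
apply: cvg_cexp; apply: cvgM; last exact: cvg_cst.
exact: cvg_punctured_id.
Qed.

Lemma cvg_pow_ratio n b :
  pow_ratio n a @[a --> within (@punctured_plane R) (nbhs b)] --> pow_ratio n b.
Proof.
apply: cvgM; first exact: cvg_natpowC.
apply: (@cvg_prodC R _ _ _ n (fun j a => 1 - a / j.+1%:R)
  (fun j => 1 - b / j.+1%:R)) => j _.
apply: cvgB; first exact: cvg_cst.
by apply: cvgM; [exact: cvg_punctured_id|exact: cvg_cst].
Qed.

Lemma cvg_corrected_sum M b : punctured_plane b ->
  corrected_sum M a @[a --> within (@punctured_plane R) (nbhs b)] --> corrected_sum M b.
Proof.
move=> bD; have b1 : complex.Re b < 1 by apply: left_plane_lt1; case: bD.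
have hP : P a M.+2 @[a --> within (@punctured_plane R) (nbhs b)] --> P b M.+2.
  apply: (@cvg_sumC R _ _ _ M.+2 (fun n a => natpowC n a * (q n)%:C)
    (fun n => natpowC n b * (q n)%:C)) => n _.
  by apply: cvgM; [exact: cvg_natpowC|exact: cvg_cst].
have hS : S a M.+2 @[a --> within (@punctured_plane R) (nbhs b)] --> S b M.+2.
  apply: (@cvg_sumC R _ _ _ M.+2 (fun n a => (q n)%:C * beta a n)
    (fun n => (q n)%:C * beta b n)) => n _.
  by apply: cvgM; [exact: cvg_cst|exact: cvg_betaC].
have hLS : L a - S a M.+2 @[a --> within (@punctured_plane R) (nbhs b)] -->
    L b - S b M.+2.
  exact: (cvgB (L_cvg bD) hS).
have hr := @cvg_pow_ratio M.+1 b.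
exact: (cvgD hP (cvgM hr hLS)).
Qed.

Lemma cvg_sum_const b : punctured_plane b ->
  sum_const a @[a --> within (@punctured_plane R) (nbhs b)] --> sum_const b.
Proof.
move=> bD.
have h1 : cmod (1 - a) @[a --> within (@punctured_plane R) (nbhs b)] --> cmod (1 - b).
  by apply: cvg_cmod; apply: cvgB; [exact: cvg_cst|exact: cvg_punctured_id].
have h2 : step_const a @[a --> within (@punctured_plane R) (nbhs b)] --> step_const b.
  apply: cvgM => //; apply: cvgM; first exact: cvg_cst.
  by apply: cvg_cmod; exact: cvg_punctured_id.
have h3 : expR (step_const a) @[a --> within (@punctured_plane R) (nbhs b)] -->
    expR (step_const b).
  exact: (cvg_comp _ _ h2 (@continuous_expR R _)).
have h4 : cmod (L a) + 2 @[a --> within (@punctured_plane R) (nbhs b)] -->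
    cmod (L b) + 2.
  by apply: cvgD; [apply: cvg_cmod; exact: L_cvg|exact: cvg_cst].
by apply: cvgM => //; apply: cvgM => //; exact: cvgM.
Qed.

Definition extension a : R[i] := limn (fun M => corrected_sum M a).

Lemma extension_cvg :
  (forall a, punctured_plane a -> (fun M => corrected_sum M a) @ \oo --> extension a) /\
  (forall b, punctured_plane b ->
    extension a @[a --> within (@punctured_plane R) (nbhs b)] --> extension b).
Proof.
apply: (@continuous_limn R (@punctured_plane R) corrected_sum).
  by move=> M b; exact: cvg_corrected_sum.
move=> b bD; exists (fun m => (sum_const b + 1) * (2 * (Num.sqrt m.+1%:R)^-1)).
  rewrite -[X in _ --> X](mulr0 (sum_const b + 1)); apply: cvgM; first exact: cvg_cst.
  by rewrite -[X in _ --> X](mulr0 2); apply: cvgM; [exact: cvg_cst|exact: cvg_sqrtV].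
have hr : \forall a \near within (@punctured_plane R) (nbhs b), sum_const a < sum_const b + 1.
  by apply: (cvgr_lt _ (@cvg_sum_const b bD)); rewrite ltrDl.
near=> a; move=> m k mk.
have [aL _] : punctured_plane a by near: a; exact: withinT.
apply: le_trans (corrected_sum_diff aL mk) _.
apply: ler_wpM2r; first by rewrite mulr_ge0 // invr_ge0 sqrtr_ge0.
by apply: ltW; near: a.
Unshelve. all: by end_near. Qed.

Lemma cvg_power_sum a : complex.Re a < 2^-1 -> P a @ \oo --> extension a.
Proof.
move=> a2; have aD := punctured_plane_of_lt a2; have aL : left_plane a by case: aD.
rewrite -(cvg_shiftn 2).
have h0 : (fun M => pow_ratio M.+1 a * (L a - S a M.+2)) @ \oo --> (0 : R[i]).
  have hS : (fun M => S a M.+2) @ \oo --> L a.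
    have := L_sum a2; rewrite -(cvg_shiftn 2).
    by rewrite (_ : [sequence _]_n = (fun M => S a M.+2)) //; apply/funext => M /=;
        rewrite addn2.
  have hc : (fun M => ratio_bound a * cmod (L a - S a M.+2)) @ \oo --> (0 : R).
    rewrite -[X in _ --> X](mulr0 (ratio_bound a)); apply: cvgM; first exact: cvg_cst.
    rewrite -(cmod0 R) -(subrr (L a)); apply: cvg_cmod.
    by apply: cvgB; [exact: cvg_cst|exact: hS].
  apply/cvg_cmodP => e e0; have /cvgrPdist_lt /(_ _ e0) := hc.
  apply: filterS => M; rewrite !sub0r normrN cmodN; apply: le_lt_trans.
  apply: le_trans (ler_norm _); rewrite cmodM ler_wpM2r ?cmod_ge0 //.
  by apply: pow_ratio_le; apply: ltW; exact: left_plane_lt1.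
have [h _] := extension_cvg.
rewrite -[extension a]subr0.
rewrite (_ : [sequence _]_n = (fun M =>
    corrected_sum M a - pow_ratio M.+1 a * (L a - S a M.+2))).
  exact: (cvgB (h a aD) h0).
by apply/funext => M /=; rewrite addn2 /corrected_sum addrK.
Qed.

End Powers.

(** * Moments of the total progeny *)

Section ProgenyMoments.
Variables (R : realType) (p : nat -> R) (W : R).
Hypothesis p_ge0 : forall i, 0 <= p i.
Hypothesis p0_gt0 : 0 < p 0.
Hypothesis p_sum : (fun n => \sum_(i < n) p i) @ \oo --> (1 : R).
Hypothesis p_mean : (fun n => \sum_(i < n) i%:R * p i) @ \oo --> (1 : R).
Hypothesis p_var : (fun n => \sum_(i < n) (i%:R - 1) ^+ 2 * p i) @ \oo --> W.

Let q n := forest_pmf p n 1.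
Let A u := ln (gap p u).
Let B u := ln (pgf p u).
Let dA u := (gap p u)^-1 * dgap p u.
Let dB u := (pgf p u)^-1 * dpgf p u.
Let K := `|ln (p 0)| + `|ln W|.

Let gapP u : 0 < u < 1 -> p 0 <= gap p u <= W.
Proof.
by move=> /andP[u0 u1]; apply: (gap_bounds p_ge0 p_sum p_mean p_var); rewrite ltW.
Qed.

Let pgfP u : 0 < u < 1 -> p 0 <= pgf p u <= 1.
Proof. by move=> /andP[u0 u1]; apply: (pgf_bounds p_ge0 p_sum); rewrite !ltW. Qed.

Let gap_gt0 u : 0 < u < 1 -> 0 < gap p u.
Proof. by move=> /gapP/andP[h _]; exact: lt_le_trans h. Qed.

Let pgf_gt0 u : 0 < u < 1 -> 0 < pgf p u.
Proof. by move=> /pgfP/andP[h _]; exact: lt_le_trans h. Qed.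

Let ZE u : 0 < u < 1 -> gf_inverse A B u = u / pgf p u.
Proof.
move=> u01; have g0 := gap_gt0 u01; have f0 := pgf_gt0 u01.
have u1 : 1 - u != 0 by rewrite subr_eq0 gt_eqF //; case/andP: u01.
rewrite /gf_inverse /A /B expRB !lnK ?posrE // /gap.
by field; rewrite gt_eqF.
Qed.

Let Z_ge0 u : 0 < u < 1 -> 0 <= gf_inverse A B u.
Proof.
move=> u01; rewrite ZE // divr_ge0 ?ltW ?pgf_gt0 //; by case/andP: u01.
Qed.

Let gfZ u : 0 < u < 1 ->
  (fun M => \sum_(n < M) q n * gf_inverse A B u ^+ n) @ \oo --> u.
Proof.
move=> u01; have /andP[u0 u1] := u01.
have u01' : 0 <= u <= 1 by rewrite !ltW.
apply: (progeny_gf p_ge0 _ (cvg_pgf p_ge0 p_sum u01')) => //.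
- by move=> n; exact: (partial_sum_le n p_ge0 p_sum).
- by case/andP: (pgfP u01).
- by rewrite Z_ge0 //=; exact: Z_lt1.
- by rewrite ZE // mulfVK // gt_eqF // pgf_gt0.
Qed.

Let A_derive (u : R) : 0 < u < 1 -> is_derive u 1 A (dA u).
Proof.
move=> u01; have h := derive_gap p_ge0 p_sum p_mean p_var u01.
exact: (@is_derive1_comp _ (@ln R) (gap p) u _ _ (is_derive1_ln (gap_gt0 u01)) h).
Qed.

Let B_derive (u : R) : 0 < u < 1 -> is_derive u 1 B (dB u).
Proof.
move=> u01; have u1 : `|u| < 1 by case/andP: u01 => u0 u1; rewrite gtr0_norm.
have h := derive_pgf p_ge0 p_sum p_mean p_var u1.
exact: (@is_derive1_comp _ (@ln R) (pgf p) u _ _ (is_derive1_ln (pgf_gt0 u01)) h).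
Qed.

Let dA_ge0 u : 0 < u < 1 -> 0 <= dA u.
Proof.
move=> u01; rewrite mulr_ge0 ?invr_ge0 ?(ltW (gap_gt0 u01)) //.
exact: (dgap_ge0 p_ge0 p_sum p_mean p_var).
Qed.

Let dB_ge0 u : 0 < u < 1 -> 0 <= dB u.
Proof.
move=> u01; rewrite mulr_ge0 ?invr_ge0 ?(ltW (pgf_gt0 u01)) //.
exact: (dpgf_ge0 p_ge0 p_sum p_mean p_var).
Qed.

Lemma ln_between (x y z : R) : 0 < x -> x <= y <= z -> `|ln y| <= `|ln x| + `|ln z|.
Proof.
move=> x0 /andP[xy yz]; have y0 := lt_le_trans x0 xy; have z0 := lt_le_trans y0 yz.
have h1 : ln x <= ln y by rewrite ler_ln ?posrE.
have h2 : ln y <= ln z by rewrite ler_ln ?posrE.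
have := ler_norm (ln z); have := ler_norm (- ln x); rewrite normrN.
have := normr_ge0 (ln x); have := normr_ge0 (ln z) => h3 h4 h5 h6.
by rewrite ler_norml; apply/andP; split; lra.
Qed.

Let A_bound u : 0 < u < 1 -> `|A u| <= K.
Proof. by move=> u01; exact: ln_between (gapP u01). Qed.

Let B_bound u : 0 < u < 1 -> `|B u| <= K.
Proof.
move=> u01; apply: le_trans (ln_between p0_gt0 (pgfP u01)) _.
by rewrite ln1 normr0 addr0 lerDl.
Qed.

Lemma progeny_moment_extension : exists f : R[i] -> R[i],
  (forall b, punctured_plane b -> f a @[a -->
      within (@punctured_plane R) (nbhs b)] --> f b) /\
  (forall a, complex.Re a < 2^-1 ->
    (fun M => \sum_(n < M) natpowC n a * (q n)%:C) @ \oo --> f a).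
Proof.
have q_ge0 n : 0 <= q n by exact: forest_pmf_ge0.
have q0 : q 0 = 0 by [].
have [_ Lc] := limit_remainder_cvg q_ge0 q0 Z_ge0 gfZ A_derive B_derive dA_ge0 dB_ge0
  A_bound B_bound.
have Ls := cvg_sum_beta q_ge0 q0 Z_ge0 gfZ A_derive B_derive dA_ge0 dB_ge0
  A_bound B_bound.
have q1 := coef_sum_le1 q_ge0 Z_ge0 gfZ A_bound B_bound.
exists (extension q (limit_remainder q A B)); split.
  by have [_ h] := extension_cvg q_ge0 q0 q1 Lc.
by move=> a a2; exact: (cvg_power_sum q_ge0 q0 q1 Lc Ls a2).
Qed.

End ProgenyMoments.

Theorem theorem10p7 (R : realType)
  (d0 : measure_display) (T0 : measurableType d0) (P0 : probability T0 R)
  (xi : {RV P0 >-> nat})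
  (xi_mean : ('E_P0[fun w => (xi w)%:R] = 1)%E)
  (xi_var : (0 < 'V_P0[fun w => (xi w)%:R] < +oo)%E)
  (d : measure_display) (T : measurableType d) (P : probability T R)
  (N : seq nat -> {RV P >-> nat})
  (N_copies : forall v, same_law (N v) xi)
  (N_indep : mutually_independent N) :
  exists f : R[i] -> R[i],
    {within [set a | complex.Re a <= 2^-1] `\ 2^-1, continuous f} /\
    (forall a, complex.Re a < 2^-1 -> f a = mu N a).
Proof.
have N_law v i : P (N v @^-1` [set i]) = (law xi i)%:E.
  by rewrite -lawE; exact: N_copies.
have [f [fc fs]] := progeny_moment_extension (law_ge0 xi) (law0_gt0 xi_mean xi_var)
  (sum_law xi) (sum_mean_law xi_mean) (sum_var_law xi_mean xi_var).
exists f; split.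
  rewrite continuous_subspace_in => b; rewrite inE => bD.
  move=> U fU; have := fc b bD U fU.
  by rewrite /= /nbhs /= -(nbhs_subspace_in bD).
move=> a a2; apply/esym; apply: (cvg_lim (@norm_hausdorff _ _)).
rewrite (_ : (fun m => _) = (fun M =>
    \sum_(n < M) natpowC n a * (forest_pmf (law xi) n 1)%:C)).
  exact: fs.
apply/funext => -[|m]; first by rewrite big_geq // big_ord0.
rewrite -(big_mkord xpredT (fun n => natpowC n a * (forest_pmf (law xi) n 1)%:C)).
rewrite big_ltn // [forest_pmf _ 0 1]/= mulr0 add0r.
by apply: eq_bigr => n _; rewrite (progeny_pmfE N_law N_indep).
Qed.
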